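(* Given a string \(s[1..n]\) over an alphabet of size \(\sigma\), we can build a data structure that takes \((1+o(1))(n\log\sigma + n\log\log n)\) bits such that later, given the endpoints \(i \le j\) of a substring \(s[i..j]\), in \(O(\log n)\) time we can count how many distinct characters \(s[i..j]\) contains.
   Context: All logarithms are base 2. \(\sigma\) denotes the alphabet size (the number of distinct characters). Space is measured in bits and time in the standard word-RAM model with words of \(\Theta(\log n)\) bits; asymptotic notation is as \(n \to \infty\). *)

(* Defs.v *)
From Stdlib Require Import Arith List Reals Lia.
Import ListNotations.

(* Word-RAM instructions over an unbounded register file (a program only
   mentions finitely many registers).  All arithmetic is on w-bit words,
   i.e. modulo 2^w. *)
Inductive instr : Type :=
| IConst (r c : nat)
| IAdd (r a b : nat)
| ISub (r a b : nat)
| IMul (r a b : nat)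
| IDiv (r a b : nat)            (* r := a / b (0 if b = 0) *)
| IMod (r a b : nat)            (* r := a mod b (a if b = 0) *)
| IAnd (r a b : nat)
| IOr  (r a b : nat)
| IXor (r a b : nat)
| IShl (r a b : nat)
| IShr (r a b : nat)
| ILt  (r a b : nat)
| ILoad (r a : nat)
| IStore (a r : nat)
| IJz (r t : nat)
| IJmp (t : nat)
| IHalt.

Record state : Type := mkState { pc : nat; regs : nat -> nat; mem : nat -> nat }.

Definition upd (f : nat -> nat) (i v : nat) : nat -> nat :=
  fun k => if Nat.eqb k i then v else f k.

Definition step (w : nat) (P : list instr) (st : state) : state :=
  let M := 2 ^ w in
  let R := regs st in
  let nx := S (pc st) in
  let set r v := mkState nx (upd R r (v mod M)) (mem st) in
  match nth (pc st) P IHalt with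
  | IConst r c => set r c
  | IAdd r a b => set r (R a + R b)
  | ISub r a b => set r (R a + (M - R b mod M))
  | IMul r a b => set r (R a * R b)
  | IDiv r a b => set r (R a / R b)
  | IMod r a b => set r (Nat.modulo (R a) (R b))
  | IAnd r a b => set r (Nat.land (R a) (R b))
  | IOr r a b => set r (Nat.lor (R a) (R b))
  | IXor r a b => set r (Nat.lxor (R a) (R b))
  | IShl r a b => set r (R a * 2 ^ R b)
  | IShr r a b => set r (R a / 2 ^ R b)
  | ILt r a b => set r (if Nat.ltb (R a) (R b) then 1 else 0)
  | ILoad r a => set r (mem st (R a))
  | IStore a r => mkState nx R (upd (mem st) (R a) (R r mod M))
  | IJz r t => mkState (if Nat.eqb (R r) 0 then t else nx) R (mem st)
  | IJmp t => mkState t R (mem st)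
  | IHalt => st
  end.

Definition run (w : nat) (P : list instr) (k : nat) (st : state) : state :=
  Nat.iter k (step w P) st.

Definition halted (P : list instr) (st : state) : bool :=
  match nth (pc st) P IHalt with IHalt => true | _ => false end.

Fixpoint packb (bits : list bool) : nat :=
  match bits with
  | [] => 0
  | b :: t => (if b then 1 else 0) + 2 * packb t
  end.

(* The data structure D (a bit string) laid out in memory, w bits per word,
   word k holding bits k*w .. k*w+w-1; all other memory is 0. *)
Definition init_mem (w : nat) (D : list bool) : nat -> nat :=
  fun k => packb (firstn w (skipn (k * w) D)).

(* Query: register 0 = i, register 1 = j, register 2 = n; others 0.
   Answer: register 0 when the machine halts. *)
Definition init_state (w : nat) (D : list bool) (n i j : nat) : state :=
  mkState 0 (fun r => match r with 0 => i | 1 => j | 2 => n | _ => 0 end)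
          (init_mem w D).

(* s[i..j], 1-indexed inclusive *)
Definition substr (s : list nat) (i j : nat) : list nat :=
  firstn (j - i + 1) (skipn (i - 1) s).

Definition num_distinct (l : list nat) : nat := length (nodup Nat.eq_dec l).

Definition alph_size (s : list nat) : nat := num_distinct s.

Definition log2R (x : R) : R := ln x / ln 2.

(* Main.v *)
Require Import Defs.
From Stdlib Require Import Arith List Lia Bool Permutation Sorted Mergesort Orders.
Import ListNotations.

(** Cut [s] into blocks of length [B = sigma * (log n + 1)].  If [i] and [j] lie
    in the same block, the answer is the number of [k] in [i..j] whose previous
    occurrence inside the block precedes [i].  Otherwise let [b] be the end of
    the block of [i]: the missing characters are those whose first occurrence
    from [b] on comes after [j] and whose last occurrence in the block of [i]
    comes before [i].  With the [sigma] characters sorted by the former, a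
    binary search makes the first condition a range of indices.  Either way one
    counts the values below a threshold in a range of a single sequence, of
    length [n + n / log n] and with values at most [B].  It is stored as a
    wavelet matrix of [log B + O(1) = log sigma + log log n + O(1)] levels with
    constant-time rank; the sorted positions take [O(n / log n)] words. *)

Open Scope nat_scope.
#[local] Arguments Nat.div : simpl never.
#[local] Arguments Nat.modulo : simpl never.

(** * Distinct characters, links and the splitting of a query *)

(** Links to the previous occurrence in all of [s] would have values up to [n], hence [log n] levels
    and [n log n] bits. Links cut at block boundaries stay at most [B], at the price of a separate
    treatment of queries that cross a boundary. The factor [sigma] in [B] pays for one point per
    character at each boundary; the factor [log n + 1] makes the points so few that their positions,
    stored in full words, take [O(n)] bits. For a crossing query, being present is a disjunction
    over the two sides of the boundary, whereas being absent is a conjunction, hence a range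
    condition in each coordinate; this is why absent characters are counted. Since the target
    contains [n log log n] even for [sigma = 1], every [O(n)] term is of lower order, and an
    overhead per level only has to be smaller than the level by a factor of order [log log n]. The
    estimates of the directories aim at no more than that. *)

Definition cnt {A : Type} (p : A -> bool) (l : list A) : nat := length (filter p l).

Lemma cnt_app {A} (p : A -> bool) l1 l2 : cnt p (l1 ++ l2) = cnt p l1 + cnt p l2.
Proof. unfold cnt. now rewrite filter_app, length_app. Qed.

Lemma cnt_le {A} (p : A -> bool) l : cnt p l <= length l.
Proof. apply filter_length_le. Qed.

Lemma cnt_negb {A} (p : A -> bool) l :
  cnt p l + cnt (fun x => negb (p x)) l = length l.
Proof. apply filter_length. Qed.

Lemma cnt_map {A B} (f : A -> B) p l : cnt p (map f l) = cnt (fun x => p (f x)) l.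
Proof.
  unfold cnt. induction l as [|x l IH]; [reflexivity|].
  simpl. destruct (p (f x)); simpl; now rewrite IH.
Qed.

Lemma cnt_ext {A} (p q : A -> bool) l :
  (forall x, In x l -> p x = q x) -> cnt p l = cnt q l.
Proof. intros H. unfold cnt. now rewrite (filter_ext_in p q l H). Qed.

Lemma cnt_perm {A} (p : A -> bool) l1 l2 : Permutation l1 l2 -> cnt p l1 = cnt p l2.
Proof.
  unfold cnt. induction 1; simpl; auto; try congruence.
  - destruct (p x); simpl; congruence.
  - destruct (p x), (p y); reflexivity.
Qed.

Lemma cnt_none {A} (p : A -> bool) l : (forall x, In x l -> p x = false) -> cnt p l = 0.
Proof.
  induction l as [|a l IH]; intros H; [reflexivity|].
  unfold cnt in *. simpl. rewrite H by now left. apply IH. intros; apply H; now right.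
Qed.

Lemma filter_cons {A} (p : A -> bool) a l : filter p (a :: l) = (if p a then [a] else []) ++ filter p l.
Proof. simpl. now destruct (p a). Qed.

Lemma cnt_cons {A} (p : A -> bool) a l : cnt p (a :: l) = Nat.b2n (p a) + cnt p l.
Proof. unfold cnt. simpl. now destruct (p a). Qed.

Definition memb (a : nat) (l : list nat) : bool := existsb (Nat.eqb a) l.

Lemma memb_In a l : memb a l = true <-> In a l.
Proof.
  unfold memb. rewrite existsb_exists. split.
  - intros [x [Hx E]]. apply Nat.eqb_eq in E. now subst.
  - intros H. exists a. now rewrite Nat.eqb_refl.
Qed.

Lemma memb_app a l1 l2 : memb a (l1 ++ l2) = memb a l1 || memb a l2.
Proof. apply existsb_app. Qed.

Lemma num_distinct_incl l s :
  incl l s -> num_distinct l = cnt (fun a => memb a l) (nodup Nat.eq_dec s).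
Proof.
  intros H. unfold num_distinct, cnt.
  apply Permutation_length, NoDup_Permutation.
  - apply NoDup_nodup.
  - apply NoDup_filter, NoDup_nodup.
  - intros x. rewrite filter_In, !nodup_In, memb_In. firstorder.
Qed.

Lemma num_distinct_snoc l x :
  num_distinct (l ++ [x]) = num_distinct l + Nat.b2n (negb (memb x l)).
Proof.
  rewrite (num_distinct_incl (l ++ [x]) (x :: l)), (num_distinct_incl l (x :: l)).
  2: now right.
  2: { intros y Hy. apply in_app_iff in Hy. simpl in *. tauto. }
  assert (Hx : In x (nodup Nat.eq_dec (x :: l))) by (apply nodup_In; now left).
  assert (ND := NoDup_nodup Nat.eq_dec (x :: l)).
  (* Set aside the only copy of [x]: on the remaining characters [m], membership in [l ++ [x]] and
     in [l] agree. *)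
  destruct (Add_inv _ _ Hx) as [m Hm].
  assert (Pm := Permutation_Add Hm).
  rewrite <- (cnt_perm _ _ _ Pm), <- (cnt_perm _ _ _ Pm), !cnt_cons.
  apply (Permutation_NoDup (Permutation_sym Pm)) in ND. inversion ND; subst.
  rewrite memb_app. simpl. rewrite Nat.eqb_refl, orb_true_r.
  rewrite (cnt_ext (fun a => memb a (l ++ [x])) (fun a => memb a l) m).
  - destruct (memb x l); simpl; lia.
  - intros a Ha. rewrite memb_app. simpl. rewrite orb_false_r.
    destruct (Nat.eqb_spec a x); [subst; contradiction|]. apply orb_false_r.
Qed.

(** Each character is counted once, at its first occurrence in [l]. *)
Lemma num_distinct_count l :
  num_distinct l =
  cnt (fun k => negb (memb (nth k l 0) (firstn k l))) (seq 0 (length l)).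
Proof.
  induction l as [|x l IH] using rev_ind; [reflexivity|].
  rewrite num_distinct_snoc, IH, length_app, Nat.add_1_r, seq_S, cnt_app. simpl.
  f_equal.
  - apply cnt_ext. intros k Hk. apply in_seq in Hk.
    rewrite app_nth1 by lia. rewrite firstn_app.
    replace (k - length l) with 0 by lia. now rewrite app_nil_r.
  - unfold cnt. simpl. rewrite app_nth2, Nat.sub_diag, firstn_app, Nat.sub_diag, firstn_all by lia.
    simpl. rewrite app_nil_r. now destruct (memb x l).
Qed.

(** [1 +] the index of the last occurrence, or [0]. *)
Fixpoint lastpos (a : nat) (l : list nat) : nat :=
  match l with
  | [] => 0
  | x :: t => match lastpos a t with
              | 0 => if a =? x then 1 else 0
              | S p => S (S p)
              end
  end.

Lemma lastpos_le a l : lastpos a l <= length l.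
Proof.
  induction l as [|x t IH]; simpl; [lia|].
  destruct (lastpos a t); [destruct (a =? x)|]; lia.
Qed.

(** The shift by one lets 0 encode absence: an absent character passes the same comparison as one
    that last occurs before [o]. *)
Lemma lastpos_ltb a l : forall o, (lastpos a l <? S o) = negb (memb a (skipn o l)).
Proof.
  induction l as [|x t IH]; intros o.
  - now rewrite skipn_nil.
  - destruct o as [|o].
    + specialize (IH 0). unfold memb in *. simpl in *.
      destruct (existsb (Nat.eqb a) t), (lastpos a t), (a =? x); easy.
    + simpl skipn. rewrite <- IH. simpl.
      destruct (lastpos a t) as [|p]; [now destruct (a =? x)|].
      reflexivity.
Qed.

Fixpoint firstpos (a : nat) (l : list nat) : nat :=
  match l with
  | [] => 0
  | x :: t => if a =? x then 0 else S (firstpos a t)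
  end.

Lemma firstpos_le a l : firstpos a l <= length l.
Proof. induction l as [|x t IH]; simpl; [lia|]. destruct (a =? x); lia. Qed.

(** Absence is encoded as [length l], a position past the end of every prefix; hence the bound on
    [m]. *)
Lemma firstpos_leb a l : forall m, m <= length l ->
  (m <=? firstpos a l) = negb (memb a (firstn m l)).
Proof.
  induction l as [|x t IH]; intros [|m] H; simpl in *; try reflexivity; try lia.
  destruct (a =? x); simpl; [reflexivity|]. apply IH. lia.
Qed.

(** The previous-occurrence link of [k], as a shifted offset in the block of [k]. Links that would
    leave the block become 0. *)
Definition vpos (B : nat) (s : list nat) (k : nat) : nat :=
  lastpos (nth k s 0) (firstn (k mod B) (skipn (k / B * B) s)).

Lemma vpos_le B s k : 0 < B -> vpos B s k <= B.
Proof.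
  intros HB. unfold vpos. etransitivity; [apply lastpos_le|].
  rewrite length_firstn. assert (H := Nat.mod_upper_bound k B). lia.
Qed.

Lemma seq_shift_map i z len : seq (i + z) len = map (Nat.add i) (seq z len).
Proof.
  revert z. induction len as [|len IH]; intros z; [reflexivity|].
  simpl. now rewrite <- IH, Nat.add_succ_r.
Qed.

(** A position is counted when its link falls before [i], that is, when it is the first occurrence
    of its character in the substring. The [S] in the threshold matches the shift in [lastpos]. *)
Lemma same_block_count B s i j : 0 < B -> i <= j -> j < length s -> i / B = j / B ->
  cnt (fun k => vpos B s k <? S (i mod B)) (seq i (S j - i)) =
  num_distinct (firstn (S j - i) (skipn i s)).
Proof.
  intros HB Hij Hj Hb.
  rewrite num_distinct_count, length_firstn, length_skipn, Nat.min_l by lia.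
  replace (seq i (S j - i)) with (seq (i + 0) (S j - i)) by now rewrite Nat.add_0_r.
  rewrite seq_shift_map.
  rewrite cnt_map. apply cnt_ext. intros k Hk. apply in_seq in Hk.
  unfold vpos. rewrite lastpos_ltb.
  assert (Hkb : (i + k) / B = i / B).
  { apply Nat.le_antisymm; [rewrite Hb|]; apply Nat.Div0.div_le_mono; lia. }
  rewrite Hkb. f_equal.
  assert (E1 := Nat.div_mod_eq i B). assert (E2 := Nat.div_mod_eq (i + k) B).
  rewrite Hkb in E2. f_equal.
  - rewrite firstn_skipn_comm, nth_skipn.
    rewrite nth_firstn. destruct (Nat.ltb_spec (i + k) (i + (S j - i))); [|lia]. reflexivity.
  - rewrite skipn_firstn_comm, skipn_skipn, firstn_firstn, Nat.min_l by lia.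
    f_equal; [nia|]. f_equal. nia.
Qed.

(** One pair per character around the boundary that ends block [x]: its first
    position after the boundary and its last offset before it. *)
Definition pts (B : nat) (s : list nat) (x : nat) : list (nat * nat) :=
  map (fun a => (S x * B + firstpos a (skipn (S x * B) s),
                 lastpos a (firstn B (skipn (x * B) s))))
      (nodup Nat.eq_dec s).

Lemma cross_block_count B s i j : 0 < B -> i <= j -> j < length s -> i / B < j / B ->
  cnt (fun p => (j <? fst p) && (snd p <? S (i mod B))) (pts B s (i / B))
  + num_distinct (firstn (S j - i) (skipn i s)) = alph_size s.
Proof.
  intros HB Hij Hj Hb.
  assert (Ei := Nat.div_mod_eq i B). assert (Hi := Nat.mod_upper_bound i B).
  assert (Ej := Nat.div_mod_eq j B). set (x := i / B) in *.
  assert (Hx : S x * B <= j) by nia.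
  set (l := firstn (S j - i) (skipn i s)).
  assert (El : l = firstn (S x * B - i) (skipn i s) ++ firstn (S j - S x * B) (skipn (S x * B) s)).
  { unfold l. rewrite <- (firstn_skipn (S x * B - i) (firstn (S j - i) (skipn i s))).
    rewrite firstn_firstn, Nat.min_l by lia. f_equal.
    rewrite skipn_firstn_comm, skipn_skipn.
    f_equal; [lia|]. f_equal. nia. }
  rewrite (num_distinct_incl l s).
  2: { intros y Hy. rewrite <- (firstn_skipn i s). apply in_or_app. right.
       rewrite <- (firstn_skipn (S j - i) (skipn i s)). apply in_or_app. now left. }
  unfold pts, alph_size, num_distinct. rewrite cnt_map, Nat.add_comm.
  rewrite <- (cnt_negb (fun a => memb a l)). f_equal. apply cnt_ext. intros a _.
  unfold fst, snd. rewrite lastpos_ltb, El, memb_app, negb_orb, andb_comm. f_equal.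
  - f_equal. f_equal. rewrite skipn_firstn_comm, skipn_skipn.
    f_equal; [nia|]. f_equal. nia.
  - rewrite <- firstpos_leb by (rewrite length_skipn; lia).
    destruct (Nat.ltb_spec j (S x * B + firstpos a (skipn (S x * B) s)));
      destruct (Nat.leb_spec (S j - S x * B) (firstpos a (skipn (S x * B) s))); lia || reflexivity.
Qed.

Module PairOrder <: TotalLeBool.
  Definition t := (nat * nat)%type.
  Definition leb (p q : t) : bool := fst p <=? fst q.
  Lemma leb_total : forall p q, leb p q = true \/ leb q p = true.
  Proof. intros p q. unfold leb. rewrite !Nat.leb_le. lia. Qed.
End PairOrder.
Module PairSort := Sort PairOrder.

Definition spts B s x := PairSort.sort (pts B s x).

Lemma spts_perm B s x : Permutation (pts B s x) (spts B s x).
Proof. apply PairSort.Permuted_sort. Qed.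

Lemma length_spts B s x : length (spts B s x) = alph_size s.
Proof.
  rewrite <- (Permutation_length (spts_perm B s x)). unfold pts. now rewrite length_map.
Qed.

Lemma spts_sorted B s x : StronglySorted le (map fst (spts B s x)).
Proof.
  assert (H : StronglySorted (fun p q => is_true (PairOrder.leb p q)) (spts B s x)).
  { apply PairSort.StronglySorted_sort. intros p q r. unfold is_true, PairOrder.leb.
    rewrite !Nat.leb_le. lia. }
  induction H as [|p l H IH F]; simpl; constructor; auto.
  rewrite Forall_map. eapply Forall_impl; [|exact F].
  intros q. unfold is_true, PairOrder.leb. now rewrite Nat.leb_le.
Qed.

Lemma spts_fst_le B s x p : S x * B <= length s -> In p (spts B s x) -> fst p <= length s.
Proof.
  intros Hx Hp. apply (Permutation_in _ (Permutation_sym (spts_perm B s x))) in Hp.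
  unfold pts in Hp. apply in_map_iff in Hp. destruct Hp as [a [<- _]].
  unfold fst. assert (H := firstpos_le a (skipn (S x * B) s)). rewrite length_skipn in H. lia.
Qed.

Lemma spts_snd_le B s x p : In p (spts B s x) -> snd p <= B.
Proof.
  intros Hp. apply (Permutation_in _ (Permutation_sym (spts_perm B s x))) in Hp.
  unfold pts in Hp. apply in_map_iff in Hp. destruct Hp as [a [<- _]].
  unfold snd. etransitivity; [apply lastpos_le|]. rewrite length_firstn. lia.
Qed.

(** The hypotheses on [t] are what a binary search in the sorted first coordinates delivers. They
    turn the first half of the condition into a suffix and leave a one-sided count. *)
Lemma cnt_suffix (l : list (nat * nat)) j v t :
  t <= length l ->
  (forall k, k < t -> nth k (map fst l) 0 <= j) ->
  (forall k, t <= k -> k < length l -> j < nth k (map fst l) 0) ->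
  cnt (fun p => (j <? fst p) && (snd p <? v)) l = cnt (fun y => y <? v) (skipn t (map snd l)).
Proof.
  intros Ht H1 H2.
  rewrite <- (firstn_skipn t l) at 1. rewrite cnt_app, skipn_map, cnt_map.
  rewrite cnt_none; [simpl; apply cnt_ext|].
  - intros p Hp. apply (In_nth _ _ (0, 0)) in Hp. destruct Hp as [k [Hk E]].
    rewrite length_skipn in Hk. rewrite nth_skipn in E.
    assert (H := H2 (t + k) ltac:(lia) ltac:(lia)).
    change 0 with (fst (0, 0)) in H. rewrite map_nth, E in H.
    apply Nat.ltb_lt in H. now rewrite H.
  - intros p Hp. apply (In_nth _ _ (0, 0)) in Hp. destruct Hp as [k [Hk E]].
    rewrite length_firstn in Hk. rewrite nth_firstn in E.
    destruct (Nat.ltb_spec k t); [|lia].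
    assert (H3 := H1 k ltac:(lia)).
    change 0 with (fst (0, 0)) in H3. rewrite map_nth, E in H3.
    apply Nat.ltb_ge in H3. now rewrite H3.
Qed.

(** * Wavelet matrix: stable splits and descent by bits *)

(** The whole level is split at once, not node by node, so the number of zeros of the level and
    ranks suffice to map a range to the next level. *)
Definition part (m : nat) (V : list nat) : list nat :=
  filter (fun v => negb (Nat.testbit v m)) V ++ filter (fun v => Nat.testbit v m) V.

Lemma mod_pow_S v m : v mod 2 ^ S m = v mod 2 ^ m + Nat.b2n (Nat.testbit v m) * 2 ^ m.
Proof.
  rewrite Nat.pow_succ_r', Nat.mul_comm, Nat.Div0.mod_mul_r, Nat.testbit_spec'. lia.
Qed.

(** When the descent has [m] levels left, the higher bits of the surviving values agree with those
    of the threshold. *)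
Definition below (m t : nat) (v : nat) : bool := v mod 2 ^ m <? t mod 2 ^ m.

Lemma below_S m t v :
  below (S m) t v =
  if Nat.testbit t m then negb (Nat.testbit v m) || below m t v
  else negb (Nat.testbit v m) && below m t v.
Proof.
  unfold below. rewrite !mod_pow_S.
  assert (H1 := Nat.mod_upper_bound v (2 ^ m) ltac:(apply Nat.pow_nonzero; lia)).
  assert (H2 := Nat.mod_upper_bound t (2 ^ m) ltac:(apply Nat.pow_nonzero; lia)).
  destruct (Nat.testbit t m), (Nat.testbit v m); unfold Nat.b2n; simpl orb; simpl andb; simpl negb;
  try (destruct (Nat.ltb_spec (v mod 2 ^ m) (t mod 2 ^ m)));
  (apply Nat.ltb_lt; lia) || (apply Nat.ltb_ge; lia).
Qed.

(** If the threshold has bit 1, the values with bit 0 are settled as smaller and only the others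
    stay open. If it has bit 0, the values with bit 1 are settled as not smaller. *)
Lemma cnt_below_S m t l :
  cnt (below (S m) t) l =
  if Nat.testbit t m
  then cnt (fun v => negb (Nat.testbit v m)) l + cnt (below m t) (filter (fun v => Nat.testbit v m) l)
  else cnt (below m t) (filter (fun v => negb (Nat.testbit v m)) l).
Proof.
  induction l as [|v l IH].
  - now destruct (Nat.testbit t m).
  - rewrite !filter_cons, !cnt_app, !cnt_cons, IH, below_S.
    destruct (Nat.testbit t m), (Nat.testbit v m); simpl; unfold cnt; simpl;
      destruct (below m t v); simpl; lia.
Qed.

Lemma length_part m V : length (part m V) = length V.
Proof.
  unfold part. rewrite length_app. rewrite Nat.add_comm. apply (cnt_negb (fun v => Nat.testbit v m)).
Qed.

(** * Memory layout of the rank structure *)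

Lemma pow2_pos k : 0 < 2 ^ k.
Proof. apply Nat.neq_0_lt_0, Nat.pow_nonzero. lia. Qed.

Lemma packb_app l1 l2 : packb (l1 ++ l2) = packb l1 + 2 ^ length l1 * packb l2.
Proof.
  induction l1 as [|b l1 IH]; [simpl; lia|].
  simpl app. simpl packb. simpl length. rewrite IH, Nat.pow_succ_r'. lia.
Qed.

Lemma packb_lt l : packb l < 2 ^ length l.
Proof.
  induction l as [|b l IH]; [simpl; lia|].
  simpl packb. simpl length. rewrite Nat.pow_succ_r'. destruct b; lia.
Qed.

Lemma packb_firstn_lt k l : packb (firstn k l) < 2 ^ k.
Proof.
  eapply Nat.lt_le_trans; [apply packb_lt|].
  apply Nat.pow_le_mono_r; [lia|]. rewrite length_firstn. lia.
Qed.

Lemma packb_mod k l : packb l mod 2 ^ k = packb (firstn k l).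
Proof.
  assert (Hp := packb_firstn_lt k l).
  destruct (Nat.le_gt_cases k (length l)) as [H|H].
  - rewrite <- (firstn_skipn k l) at 1.
    rewrite packb_app, length_firstn, Nat.min_l by lia.
    rewrite Nat.mul_comm, Nat.Div0.mod_add. now apply Nat.mod_small.
  - rewrite firstn_all2 in * by lia. now apply Nat.mod_small.
Qed.

Lemma packb_div k l : packb l / 2 ^ k = packb (skipn k l).
Proof.
  assert (Hp := packb_firstn_lt k l). assert (H2 := pow2_pos k).
  destruct (Nat.le_gt_cases k (length l)) as [H|H].
  - rewrite <- (firstn_skipn k l) at 1.
    rewrite packb_app, length_firstn, Nat.min_l by lia.
    rewrite Nat.mul_comm, Nat.div_add by lia. rewrite Nat.div_small; [reflexivity|exact Hp].
  - rewrite skipn_all2 by lia. apply Nat.div_small. rewrite firstn_all2 in Hp by lia. exact Hp.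
Qed.

(** Lets the popcount loop stop as soon as the remaining word is 0. *)
Lemma packb_0 l : packb l = 0 -> cnt id l = 0.
Proof.
  induction l as [|b l IH]; [reflexivity|]. simpl packb. rewrite cnt_cons.
  destruct b; simpl; intros; lia.
Qed.

Fixpoint tobits (w x : nat) : list bool :=
  match w with
  | 0 => []
  | S w' => Nat.odd x :: tobits w' (x / 2)
  end.

Lemma length_tobits w : forall x, length (tobits w x) = w.
Proof. induction w as [|w IH]; intros x; simpl; congruence. Qed.

Lemma packb_tobits w : forall x, x < 2 ^ w -> packb (tobits w x) = x.
Proof.
  induction w as [|w IH]; intros x Hx; [simpl in *; lia|].
  rewrite Nat.pow_succ_r' in Hx. simpl.
  rewrite IH by (apply Nat.Div0.div_lt_upper_bound; lia).
  assert (H := Nat.div2_odd x). rewrite Nat.div2_div in H.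
  destruct (Nat.odd x); simpl Nat.b2n in H; lia.
Qed.

Definition bits_of_words (w : nat) (l : list nat) : list bool := flat_map (tobits w) l.

Lemma length_bits_of_words w l : length (bits_of_words w l) = w * length l.
Proof.
  induction l as [|x l IH]; simpl; [lia|]. rewrite length_app, length_tobits, IH. lia.
Qed.

(** From here on the structure is a list of words; the default 0 of [nth] matches the memory beyond
    it. *)
Lemma init_mem_words w l : (forall x, In x l -> x < 2 ^ w) ->
  forall k, init_mem w (bits_of_words w l) k = nth k l 0.
Proof.
  unfold init_mem. induction l as [|x l IH]; intros H k.
  - simpl. rewrite skipn_nil, firstn_nil. now destruct k.
  - assert (L := length_tobits w x). destruct k as [|k].
    + simpl. rewrite firstn_app, L, Nat.sub_diag, firstn_all2, app_nil_r by lia.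
      apply packb_tobits, H. now left.
    + simpl nth. rewrite <- IH by (intros; apply H; now right).
      simpl bits_of_words. rewrite skipn_app, skipn_all2 by (rewrite L; lia).
      rewrite L. simpl app. do 3 f_equal. lia.
Qed.

Fixpoint popcount (fuel x : nat) : nat :=
  match fuel with
  | 0 => 0
  | S f => x mod 2 + popcount f (x / 2)
  end.

Lemma popcount_packb f : forall l, length l <= f -> popcount f (packb l) = cnt id l.
Proof.
  induction f as [|f IH]; intros [|b l] H; simpl in H; try lia.
  - reflexivity.
  - simpl. change (0 / 2) with 0.
    specialize (IH [] ltac:(simpl; lia)). simpl in IH. rewrite IH. reflexivity.
  - assert (E : packb (b :: l) = Nat.b2n b + packb l * 2) by (destruct b; simpl; lia).
    cbn [popcount]. rewrite cnt_cons, <- IH, E by lia.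
    rewrite Nat.Div0.mod_add, Nat.div_add by lia. destruct b; reflexivity.
Qed.

Lemma popcount_le f : forall x, popcount f x <= f.
Proof.
  induction f as [|f IH]; intros x; simpl; [lia|].
  assert (H := IH (x / 2)). assert (H2 := Nat.mod_upper_bound x 2). lia.
Qed.

Definition poptable (h : nat) : list nat := map (popcount h) (seq 0 (2 ^ h)).

Lemma length_poptable h : length (poptable h) = 2 ^ h.
Proof. unfold poptable. now rewrite length_map, length_seq. Qed.

Lemma nth_map_seq (f : nat -> nat) n k : k < n -> nth k (map f (seq 0 n)) 0 = f k.
Proof.
  intros H. rewrite (nth_indep _ 0 (f 0)) by (now rewrite length_map, length_seq).
  rewrite map_nth, seq_nth by lia. reflexivity.
Qed.

Lemma nth_poptable h l : length l <= h -> nth (packb l) (poptable h) 0 = cnt id l.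
Proof.
  intros H. unfold poptable. rewrite nth_map_seq; [now apply popcount_packb|].
  eapply Nat.lt_le_trans; [apply packb_lt|]. apply Nat.pow_le_mono_r; lia.
Qed.

Fixpoint packd (f : nat) (l : list nat) : nat :=
  match l with
  | [] => 0
  | d :: l => d + 2 ^ f * packd f l
  end.

Lemma packd_lt f l : (forall d, In d l -> d < 2 ^ f) -> packd f l < 2 ^ (length l * f).
Proof.
  induction l as [|d l IH]; intros H; [simpl; lia|].
  simpl packd. simpl length. rewrite Nat.mul_succ_l, Nat.add_comm, Nat.pow_add_r.
  assert (packd f l < 2 ^ (length l * f)) by (apply IH; intros; apply H; now right).
  assert (d < 2 ^ f) by (apply H; now left). nia.
Qed.

Lemma packd_nth f l : (forall d, In d l -> d < 2 ^ f) ->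
  forall t, t < length l -> packd f l / 2 ^ (t * f) mod 2 ^ f = nth t l 0.
Proof.
  induction l as [|d l IH]; intros H t Ht; [simpl in Ht; lia|].
  assert (Hd : d < 2 ^ f) by (apply H; now left). assert (Hp := pow2_pos f).
  destruct t as [|t]; simpl packd.
  - simpl. rewrite Nat.div_1_r, Nat.mul_comm, Nat.Div0.mod_add. now apply Nat.mod_small.
  - simpl nth. rewrite <- IH; [|intros; apply H; now right|simpl in Ht; lia].
    rewrite Nat.mul_succ_l, (Nat.add_comm (t * f)), Nat.pow_add_r, <- Nat.Div0.div_div.
    rewrite (Nat.mul_comm (2 ^ f)), Nat.div_add by lia.
    now rewrite (Nat.div_small d).
Qed.

Definition rank (p : nat) (bs : list bool) : nat := cnt id (firstn p bs).

Lemma rank_add a b bs : rank (a + b) bs = rank a bs + cnt id (firstn b (skipn a bs)).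
Proof.
  unfold rank. rewrite <- (firstn_skipn a (firstn (a + b) bs)), cnt_app.
  rewrite firstn_firstn, Nat.min_l by lia. rewrite firstn_skipn_comm. reflexivity.
Qed.

(** Superblock [q] covers the bits from [q * (w * K)] on: a word holding the
    number of zeros of the whole level plus the rank at the superblock start,
    a word of [K] packed relative ranks, and the [K] data words. *)
Definition lvlword (w K f : nat) (bs : list bool) (a : nat) : nat :=
  let q := a / (K + 2) in
  match a mod (K + 2) with
  | 0 => cnt negb bs + rank (q * (w * K)) bs
  | 1 => packd f (map (fun t => rank (q * (w * K) + t * w) bs - rank (q * (w * K)) bs) (seq 0 K))
  | S (S t) => packb (firstn w (skipn (q * (w * K) + t * w) bs))
  end.

(** The [+ 1] gives even position [length bs] a superblock, so the right end of a range is no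
    special case. *)
Definition lvl (w K f : nat) (bs : list bool) : list nat :=
  map (lvlword w K f bs) (seq 0 ((length bs / (w * K) + 1) * (K + 2))).

Lemma length_lvl w K f bs : length (lvl w K f bs) = (length bs / (w * K) + 1) * (K + 2).
Proof. unfold lvl. now rewrite length_map, length_seq. Qed.

Lemma nth_lvl w K f bs q r : q <= length bs / (w * K) -> r < K + 2 ->
  nth (q * (K + 2) + r) (lvl w K f bs) 0 =
  match r with
  | 0 => cnt negb bs + rank (q * (w * K)) bs
  | 1 => packd f (map (fun t => rank (q * (w * K) + t * w) bs - rank (q * (w * K)) bs) (seq 0 K))
  | S (S t) => packb (firstn w (skipn (q * (w * K) + t * w) bs))
  end.
Proof.
  intros Hq Hr. unfold lvl. rewrite nth_map_seq by nia.
  unfold lvlword. rewrite Nat.div_add_l, Nat.div_small, Nat.add_0_r by lia.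
  rewrite Nat.add_comm, Nat.Div0.mod_add, Nat.mod_small by lia. reflexivity.
Qed.

Lemma rel_rank_lt w K f bs a : w * K < 2 ^ f ->
  forall d, In d (map (fun t => rank (a + t * w) bs - rank a bs) (seq 0 K)) -> d < 2 ^ f.
Proof.
  intros H d Hd. apply in_map_iff in Hd. destruct Hd as [t [<- Ht]]. apply in_seq in Ht.
  rewrite rank_add. assert (B := cnt_le id (firstn (t * w) (skipn a bs))).
  rewrite length_firstn in B. nia.
Qed.

Lemma lvl_lt w K f bs : w * K < 2 ^ f -> K * f <= w -> length bs < 2 ^ w ->
  forall x, In x (lvl w K f bs) -> x < 2 ^ w.
Proof.
  intros H1 H2 H3 x Hx. unfold lvl in Hx. apply in_map_iff in Hx.
  destruct Hx as [a [<- _]]. unfold lvlword.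
  destruct (a mod (K + 2)) as [|[|t]].
  (* The zeros of the level and the ones of a prefix are disjoint, so their sum is at most
     [length bs]. *)
  - unfold rank. rewrite <- (firstn_skipn (a / (K + 2) * (w * K)) bs) in H3 |- * at 1.
    set (b1 := firstn _ _) in *. rewrite cnt_app.
    rewrite length_app in H3.
    assert (E1 := cnt_negb id b1). assert (E2 := cnt_le negb (skipn (a / (K + 2) * (w * K)) bs)).
    change (fun x => negb (id x)) with negb in E1. lia.
  - eapply Nat.lt_le_trans; [apply packd_lt; now apply rel_rank_lt|].
    rewrite length_map, length_seq. apply Nat.pow_le_mono_r; lia.
  - apply packb_firstn_lt.
Qed.

Fixpoint levels (w K f m : nat) (V : list nat) : list nat :=
  match m with
  | 0 => []
  | S m' => lvl w K f (map (fun v => Nat.testbit v m') V) ++ levels w K f m' (part m' V)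
  end.

Lemma length_levels w K f m : forall V,
  length (levels w K f m V) = m * ((length V / (w * K) + 1) * (K + 2)).
Proof.
  induction m as [|m IH]; intros V; [reflexivity|].
  simpl levels. rewrite length_app, length_lvl, length_map, IH, length_part. lia.
Qed.

Lemma levels_lt w K f : w * K < 2 ^ f -> K * f <= w ->
  forall m V, length V < 2 ^ w -> forall x, In x (levels w K f m V) -> x < 2 ^ w.
Proof.
  intros H1 H2. induction m as [|m IH]; intros V HV x Hx; [destruct Hx|].
  simpl in Hx. apply in_app_iff in Hx. destruct Hx as [Hx|Hx].
  - eapply lvl_lt; eauto. now rewrite length_map.
  - eapply IH; [|exact Hx]. now rewrite length_part.
Qed.

Definition seg (m : nat -> nat) (a : nat) (l : list nat) : Prop :=
  forall k, k < length l -> m (a + k) = nth k l 0.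

Lemma seg_app m a l1 l2 : seg m a (l1 ++ l2) -> seg m a l1 /\ seg m (a + length l1) l2.
Proof.
  intros H. split; intros k Hk.
  - rewrite H by (rewrite length_app; lia). now apply app_nth1.
  - rewrite <- Nat.add_assoc, H by (rewrite length_app; lia).
    rewrite app_nth2 by lia. f_equal. lia.
Qed.

(** * The query program *)

(** Jump targets are absolute, so each basic block carries its address: 34 tells
    the same-block and cross-block queries apart, 47 is the binary search, 67
    the loop over the wavelet levels, 98 the rank subroutine (it returns to 76
    or 82 according to register 29), 116 its popcount loop, and 126 the table
    lookup that replaces everything for [n < 256], where words are too short
    for the addresses of the general structure.  Block 10 loads the header
    into registers 10 to 21; registers from 30 on are scratch. *)
Definition prog : list instr :=
  [
    (* 0 *) IConst 22 1; IShr 4 2 22; IShr 4 4 22; IShr 4 4 22; IShr 4 4 22; IShr 4 4 22;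
             IShr 4 4 22; IShr 4 4 22; IShr 4 4 22; IJz 4 126;
    (* 10 *) IConst 3 0; ILoad 10 3; IConst 3 1; ILoad 11 3; IConst 3 2; ILoad 12 3;
             IConst 3 3; ILoad 13 3; IConst 3 4; ILoad 14 3; IConst 3 5; ILoad 15 3;
             IConst 3 6; ILoad 16 3; IConst 3 7; ILoad 17 3; IConst 3 8; ILoad 18 3;
             IConst 3 9; ILoad 19 3; IConst 3 10; ILoad 20 3; IConst 3 11; ILoad 21 3;
    (* 34 *) ISub 0 0 22; ISub 1 1 22; IDiv 5 0 10; IMod 6 0 10; IAdd 6 6 22; IDiv 7 1 10;
             ISub 7 7 5; IConst 9 0; IJz 7 64; IMul 7 5 11; IAdd 24 19 7; IConst 26 0;
             IMul 27 11 22;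
    (* 47 *) ISub 3 27 26; IJz 3 59; IAdd 3 26 27; IShr 3 3 22; IAdd 4 24 3; ILoad 4 4;
             ILt 4 1 4; IJz 4 57; IMul 27 3 22; IJmp 47;
    (* 57 *) IAdd 26 3 22; IJmp 47;
    (* 59 *) IAdd 7 2 7; IAdd 26 26 7; IAdd 27 7 11; IMul 8 11 22; IJmp 67;
    (* 64 *) IMul 26 0 22; IAdd 27 1 22; IConst 8 0;
    (* 67 *) IJz 12 94; ISub 12 12 22; IConst 31 2; IShr 25 6 12; IMod 25 25 31;
             ILoad 24 20; IConst 29 0; IMul 28 26 22; IJmp 98;
    (* 76 *) IMul 4 30 22; IAdd 23 26 24; ISub 23 23 30; IMul 28 27 22; IConst 29 1;
             IJmp 98;
    (* 82 *) IAdd 3 27 24; ISub 3 3 30; IAdd 20 20 21; IJz 25 91; ISub 7 3 23; IAdd 9 9 7;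
             IMul 26 4 22; IMul 27 30 22; IJmp 67;
    (* 91 *) IMul 26 23 22; IMul 27 3 22; IJmp 67;
    (* 94 *) IJz 8 96; ISub 9 8 9;
    (* 96 *) IMul 0 9 22; IHalt;
    (* 98 *) IDiv 31 28 13; IMul 31 31 14; IAdd 31 31 20; ILoad 30 31; IMod 32 28 13;
             IDiv 33 32 15; IMod 34 32 15; IAdd 31 31 22; ILoad 35 31; IMul 36 33 16;
             IShr 35 35 36; IMod 35 35 17; IAdd 30 30 35; IAdd 31 31 22; IAdd 31 31 33;
             ILoad 35 31; IShl 36 22 34; IMod 35 35 36;
    (* 116 *) IJz 35 124; IMod 36 35 18; IConst 31 12; IAdd 36 36 31; ILoad 36 36;
             IAdd 30 30 36; IDiv 35 35 18; IJmp 116;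
    (* 124 *) IJz 29 76; IJmp 82;
    (* 126 *) IAdd 3 2 22; IMul 3 3 0; IAdd 3 3 1; ILoad 0 3
  ].


(** * Symbolic execution with a step budget *)

(** [k] is a budget, not the exact time, so branches of different lengths share one statement. *)
Definition reach (w : nat) (P : list instr) (k : nat) (st : state) (Q : state -> Prop) : Prop :=
  exists t, t <= k /\ Q (run w P t st).

Lemma reach_now w P k st (Q : state -> Prop) : Q st -> reach w P k st Q.
Proof. intros H. exists 0. split; [lia|exact H]. Qed.

Lemma reach_step w P k st Q : reach w P k (step w P st) Q -> reach w P (S k) st Q.
Proof.
  intros [t [Ht H]]. exists (S t). split; [lia|]. unfold run in *. now rewrite Nat.iter_succ_r.
Qed.

Lemma reach_seq w P k1 k2 k st (Q1 Q2 : state -> Prop) :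
  reach w P k1 st Q1 -> k1 + k2 <= k -> (forall st', Q1 st' -> reach w P k2 st' Q2) ->
  reach w P k st Q2.
Proof.
  intros [t1 [H1 HQ]] Hk H. destruct (H _ HQ) as [t2 [H2 HQ2]].
  exists (t2 + t1). split; [lia|]. unfold run in *. now rewrite Nat.iter_add.
Qed.

Lemma reach_mono w P k1 k2 st Q : k1 <= k2 -> reach w P k1 st Q -> reach w P k2 st Q.
Proof. intros H [t [Ht HQ]]. exists t. split; [lia|exact HQ]. Qed.

(** Each step names its intended value [v]; wraparound is excluded once and for all by
    [v < 2 ^ w]. *)
Lemma ex_set w P pc R m k Q r x v :
  step w P (mkState pc R m) = mkState (S pc) (upd R r (x mod 2 ^ w)) m ->
  x = v -> v < 2 ^ w ->
  reach w P k (mkState (S pc) (upd R r v) m) Q -> reach w P (S k) (mkState pc R m) Q.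
Proof.
  intros Hs Hx Hv H. apply reach_step. rewrite Hs, Hx, Nat.mod_small by exact Hv. exact H.
Qed.

Lemma ex_sub w P pc R m k Q r a b v :
  nth pc P IHalt = ISub r a b -> R a = v + R b -> R a < 2 ^ w ->
  reach w P k (mkState (S pc) (upd R r v) m) Q -> reach w P (S k) (mkState pc R m) Q.
Proof.
  intros Hs Hx Hv H. apply reach_step. unfold step. simpl. rewrite Hs.
  rewrite (Nat.mod_small (R b)) by lia.
  replace (R a + (2 ^ w - R b)) with (v + 1 * 2 ^ w) by lia.
  rewrite Nat.Div0.mod_add, Nat.mod_small by lia. exact H.
Qed.

Lemma ex_jmp w P pc R m k Q t :
  nth pc P IHalt = IJmp t ->
  reach w P k (mkState t R m) Q -> reach w P (S k) (mkState pc R m) Q.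
Proof. intros Hs H. apply reach_step. unfold step. simpl. now rewrite Hs. Qed.

Lemma ex_jz_taken w P pc R m k Q r t :
  nth pc P IHalt = IJz r t -> R r = 0 ->
  reach w P k (mkState t R m) Q -> reach w P (S k) (mkState pc R m) Q.
Proof. intros Hs Hr H. apply reach_step. unfold step. simpl. now rewrite Hs, Hr. Qed.

Lemma ex_jz_next w P pc R m k Q r t :
  nth pc P IHalt = IJz r t -> R r <> 0 ->
  reach w P k (mkState (S pc) R m) Q -> reach w P (S k) (mkState pc R m) Q.
Proof.
  intros Hs Hr H. apply reach_step. unfold step. simpl. rewrite Hs.
  destruct (Nat.eqb_spec (R r) 0); [contradiction|exact H].
Qed.

Ltac look :=
  cbn [regs mem pc upd Nat.eqb];
  repeat match goal with H : ?R ?k = _ |- context [?R ?k] => rewrite H end.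
Ltac stp v := eapply (ex_set _ _ _ _ _ _ _ _ _ v); [reflexivity | look; try reflexivity; try lia | try lia | ].
Ltac sub v := eapply (ex_sub _ _ _ _ _ _ _ _ _ _ v); [reflexivity | look; try lia | look; try lia | ].
Ltac jmp := eapply ex_jmp; [reflexivity | ].
Ltac jz_taken := eapply ex_jz_taken; [reflexivity | look; try reflexivity; try lia | ].
Ltac jz_next := eapply ex_jz_next; [reflexivity | look; try lia | ].

(** A round clears [h] bits with 8 instructions, and the exit costs 1. The table starts at address
    12, behind the 12 header words. *)
Lemma popcount_run w h m c u : forall l R,
  1 <= w -> 2 ^ h < 2 ^ w -> 12 + 2 ^ h <= 2 ^ w -> seg m 12 (poptable h) ->
  length l <= u * h -> length l <= w ->
  R 35 = packb l -> R 30 = c -> R 18 = 2 ^ h -> c + cnt id l < 2 ^ w ->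
  reach w prog (8 * u + 1) (mkState 116 R m)
    (fun st => pc st = 124 /\ mem st = m /\ regs st 30 = c + cnt id l /\
               forall r, r < 30 -> regs st r = R r).
Proof.
  revert c. induction u as [|u IH]; intros c l R Hw Hh Hh2 Hseg Hlu Hlw H35 H30 H18 Hc.
  - assert (l = []) by (destruct l; simpl in *; [reflexivity|lia]). subst l.
    jz_taken. apply reach_now. simpl. rewrite H30. unfold cnt. simpl. repeat split; auto; lia.
  - replace (8 * S u + 1) with (8 + (8 * u + 1)) by lia.
    destruct (Nat.eq_dec (packb l) 0) as [E|E].
    + jz_taken. apply reach_now. simpl. rewrite H30, packb_0 by exact E. repeat split; auto; lia.
    + assert (Hl : packb l < 2 ^ w).
      { eapply Nat.lt_le_trans; [apply packb_lt|]. apply Nat.pow_le_mono_r; lia. }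
      assert (Hf := packb_firstn_lt h l).
      assert (Ec : cnt id l = cnt id (firstn h l) + cnt id (skipn h l))
        by (rewrite <- cnt_app; now rewrite firstn_skipn).
      assert (Hs : packb (skipn h l) <= packb l).
      { rewrite <- packb_div. apply Nat.Div0.div_le_upper_bound.
        assert (Hp := pow2_pos h). nia. }
      jz_next.
      stp (packb (firstn h l)); [apply packb_mod|].
      stp 12.
      stp (12 + packb (firstn h l)).
      stp (cnt id (firstn h l)).
      { rewrite Hseg by (now rewrite length_poptable). apply nth_poptable.
        rewrite length_firstn. lia. }
      stp (c + cnt id (firstn h l)).
      stp (packb (skipn h l)); [apply packb_div|].
      jmp.
      eapply reach_seq; [apply (IH (c + cnt id (firstn h l)) (skipn h l))| | ]; try lia; try reflexivity; auto.
      * rewrite length_skipn. lia.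
      * rewrite length_skipn. lia.
      * instantiate (1 := 0). lia.
      * intros st [Hpc [Hm [H3 Hfr]]]. apply reach_now. split; [|split; [|split]]; auto; [lia|].
        intros r Hr. rewrite Hfr by lia. unfold upd.
        do 37 (destruct r as [|r]; [reflexivity || lia|]). reflexivity.
Qed.

Lemma div_le_self a b : a / b <= a.
Proof.
  destruct b as [|b]; [apply Nat.le_0_l|]. apply Nat.Div0.div_le_upper_bound. lia.
Qed.

(** [sane_wK] lets a relative rank fit into a field of [f] bits, [sane_f] lets [K] fields fit into a
    word, and [sane_u] bounds the popcount rounds by [u]. *)
Record sane (w K f h u : nat) (m : nat -> nat) : Prop := {
  sane_w : 1 <= w;
  sane_K : 1 <= K;
  sane_f : K * f <= w;
  sane_fw : f < w;
  sane_wK : w * K < 2 ^ f;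
  sane_h : 12 + 2 ^ h <= 2 ^ w;
  sane_u : w <= u * h;
  sane_tab : seg m 12 (poptable h) }.

(** The 1 in register 22 serves to copy (multiply by it), to halve (shift by it), to increment and
    to decrement. *)
Definition consts (w K f h : nat) (R : nat -> nat) : Prop :=
  R 13 = w * K /\ R 14 = K + 2 /\ R 15 = w /\ R 16 = f /\ R 17 = 2 ^ f /\ R 18 = 2 ^ h /\ R 22 = 1.

Ltac fresh_reg r := do 37 (destruct r as [|r]; [reflexivity || lia|]); reflexivity.

(** The position is split into superblock [q], word [t] and bit [o]. The result includes the zeros
    of the level: it is already the image of [p] in the half of the ones. The cost is 18
    instructions and one popcount. *)
Lemma rank_run w K f h u m bs base p R :
  sane w K f h u m -> consts w K f h R ->
  seg m base (lvl w K f bs) -> base + length (lvl w K f bs) <= 2 ^ w ->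
  length bs < 2 ^ w -> p <= length bs -> R 28 = p -> R 20 = base ->
  reach w prog (8 * u + 19) (mkState 98 R m)
    (fun st => pc st = 124 /\ mem st = m /\ regs st 30 = cnt negb bs + rank p bs /\
               forall r, r < 30 -> regs st r = R r).
Proof.
  intros [Hw HK Hf Hfw HwK Hh Hu Htab] (H13 & H14 & H15 & H16 & H17 & H18 & H22)
    Hseg Hlen Hbs Hp H28 H20.
  set (q := p / (w * K)). set (t := p mod (w * K) / w). set (o := p mod (w * K) mod w).
  assert (HW : 0 < w * K) by nia.
  assert (Eq : p = q * (w * K) + (t * w + o)).
  { unfold q, t, o. rewrite (Nat.div_mod_eq p (w * K)) at 1.
    rewrite (Nat.div_mod_eq (p mod (w * K)) w) at 1. lia. }
  assert (Ht : t < K).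
  { unfold t. apply Nat.Div0.div_lt_upper_bound. rewrite (Nat.mul_comm w K).
    apply Nat.mod_upper_bound. lia. }
  assert (Ho : o < w) by (apply Nat.mod_upper_bound; lia).
  assert (Hq : q <= length bs / (w * K)) by (now apply Nat.Div0.div_le_mono).
  rewrite length_lvl in Hlen.
  set (nsb := length bs / (w * K)) in *.
  assert (Hidx : q * (K + 2) + (K + 2) <= (nsb + 1) * (K + 2)) by nia.
  assert (Hin : forall r, r < K + 2 -> q * (K + 2) + r < length (lvl w K f bs))
    by (intros r Hr; rewrite length_lvl; fold nsb; lia).
  assert (Hlv := fun r Hr => eq_trans (Hseg (q * (K + 2) + r) (Hin r Hr)) (nth_lvl w K f bs q r Hq Hr)).
  set (dir := packd f (map (fun t => rank (q * (w * K) + t * w) bs - rank (q * (w * K)) bs) (seq 0 K))) in *.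
  set (abs := cnt negb bs + rank (q * (w * K)) bs) in *.
  set (word := packb (firstn w (skipn (q * (w * K) + t * w) bs))).
  assert (H0 := Hlv 0 ltac:(lia)). assert (H1 := Hlv 1 ltac:(lia)).
  assert (H2 := Hlv (S (S t)) ltac:(lia)). cbv beta iota in H0, H1, H2. fold word in H2.
  set (rel := rank (q * (w * K) + t * w) bs - rank (q * (w * K)) bs).
  assert (Edir : dir / 2 ^ (t * f) mod 2 ^ f = rel).
  { unfold dir. rewrite packd_nth; [|now apply rel_rank_lt|now rewrite length_map, length_seq].
    now rewrite nth_map_seq. }
  set (l := firstn o (skipn (q * (w * K) + t * w) bs)).
  assert (El : word mod 2 ^ o = packb l).
  { unfold word. rewrite packb_mod, firstn_firstn, Nat.min_l by lia. reflexivity. }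
  assert (Esum : abs + rel + cnt id l = cnt negb bs + rank p bs).
  { unfold abs, rel, l. rewrite Eq at 1.
    rewrite (Nat.add_assoc (q * (w * K))), (rank_add (q * (w * K) + t * w)).
    assert (E := rank_add (q * (w * K)) (t * w) bs). lia. }
  assert (Hsum : cnt negb bs + rank p bs <= length bs).
  { assert (E := cnt_negb id bs). change (fun x => negb (id x)) with negb in E.
    assert (rank p bs <= cnt id bs); [|lia].
    unfold rank. rewrite <- (firstn_skipn p bs) at 2. rewrite cnt_app. lia. }
  assert (Hdir : dir < 2 ^ w).
  { eapply Nat.lt_le_trans; [apply packd_lt; now apply rel_rank_lt|].
    rewrite length_map, length_seq. apply Nat.pow_le_mono_r; lia. }
  assert (Hword : word < 2 ^ w) by apply packb_firstn_lt.
  assert (Hl : packb l < 2 ^ w).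
  { rewrite <- El. eapply Nat.le_lt_trans; [apply Nat.Div0.mod_le|exact Hword]. }
  assert (Hww : w < 2 ^ w) by (apply Nat.pow_gt_lin_r; lia).
  assert (Ho2 : 2 ^ o < 2 ^ w) by (apply Nat.pow_lt_mono_r; lia).
  assert (Htf : t * f <= w) by (assert (t * f <= K * f) by (apply Nat.mul_le_mono_r; lia); lia).
  assert (Hshift : dir / 2 ^ (t * f) <= dir).
  { apply div_le_self. }
  assert (Hrel : rel < 2 ^ w) by lia.
  assert (Hmod : p mod (w * K) <= p) by apply Nat.Div0.mod_le.
  assert (Ht2 : t <= p) by (eapply Nat.le_trans; [apply div_le_self|exact Hmod]).
  assert (Hq2 : q <= q * (K + 2)) by lia.
  replace (8 * u + 19) with (18 + (8 * u + 1)) by lia.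
  stp q.
  stp (q * (K + 2)).
  stp (base + q * (K + 2)).
  stp abs. { rewrite <- H0. f_equal. lia. }
  stp (p mod (w * K)).
  stp t.
  stp o.
  stp (base + q * (K + 2) + 1).
  stp dir. { rewrite <- H1. f_equal. lia. }
  stp (t * f).
  stp (dir / 2 ^ (t * f)).
  stp rel.
  stp (abs + rel).
  stp (base + q * (K + 2) + 2).
  stp (base + q * (K + 2) + 2 + t).
  stp word. { rewrite <- H2. f_equal. lia. }
  stp (2 ^ o).
  stp (packb l).
  eapply reach_seq; [apply (popcount_run w h m (abs + rel) u l)| | ]; auto; try lia.
  - unfold l. rewrite length_firstn. lia.
  - unfold l. rewrite length_firstn. lia.
  - instantiate (1 := 0). lia.
  - intros st [Hpc [Hm [H3 Hfr]]]. apply reach_now. split; [|split; [|split]]; auto; [lia|].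
    intros r Hr. rewrite Hfr by lia. unfold upd. fresh_reg r.
Qed.

Lemma length_filter_negb (q : nat -> bool) V :
  length (filter (fun v => negb (q v)) V) = cnt negb (map q V).
Proof. now rewrite cnt_map. Qed.

Lemma rank_map_prefix (q : nat -> bool) A B :
  rank (length A) (map q (A ++ B)) = length (filter q A).
Proof.
  unfold rank. rewrite map_app, firstn_app, length_map, Nat.sub_diag, firstn_O, app_nil_r.
  rewrite firstn_all2 by (now rewrite length_map). now rewrite cnt_map.
Qed.

Ltac via_frame H := rewrite H by lia; look; reflexivity || lia.

(* The queried range is tracked as the middle part [Q] of a decomposition
   [A ++ Q ++ C] of the current level. *)
Lemma loop_run w K f h u m t lsz n : sane w K f h u m -> 2 * n < 2 ^ w -> t < 2 ^ w ->
  lsz = (n / (w * K) + 1) * (K + 2) ->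
  forall L A Q C base c R, length (A ++ Q ++ C) = n ->
  consts w K f h R -> R 6 = t -> R 9 = c -> R 12 = L -> R 20 = base -> R 21 = lsz ->
  R 26 = length A -> R 27 = length A + length Q ->
  seg m base (levels w K f L (A ++ Q ++ C)) -> base + L * lsz < 2 ^ w -> L < 2 ^ w ->
  c + length Q < 2 ^ w ->
  reach w prog (L * (16 * u + 70) + 1) (mkState 67 R m)
    (fun st => pc st = 94 /\ mem st = m /\ regs st 9 = c + cnt (below L t) Q /\
               regs st 8 = R 8 /\ regs st 22 = 1).
Proof.
  intros Hs Hn Ht Hlsz. induction L as [|L IH];
    intros A Q C base c R HV Hc H6 H9 H12 H20 H21 H26 H27 Hseg Hbase HL Hcnt.
  - jz_taken. apply reach_now. simpl. destruct Hc as (_ & _ & _ & _ & _ & _ & H22).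
    rewrite H9, H22. repeat split; auto. rewrite cnt_none; [lia|].
    intros x _. unfold below. simpl. now rewrite !Nat.mod_1_r.
  - simpl levels in Hseg. apply seg_app in Hseg. destruct Hseg as [Hs1 Hs2].
    set (V := A ++ Q ++ C) in *. set (bs := map (fun v => Nat.testbit v L) V) in *.
    assert (Hbs : length bs = n) by (unfold bs; now rewrite length_map).
    assert (Hlvl : length (lvl w K f bs) = lsz) by (now rewrite length_lvl, Hbs).
    rewrite Hlvl in Hs2.
    set (q := fun v => Nat.testbit v L) in *. set (q' := fun v => negb (q v)).
    set (A1 := filter q A). set (A0 := filter q' A).
    set (Q1 := filter q Q). set (Q0 := filter q' Q).
    set (C1 := filter q C). set (C0 := filter q' C).
    assert (EA : length A1 + length A0 = length A) by apply (cnt_negb q).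
    assert (EQ : length Q1 + length Q0 = length Q) by apply (cnt_negb q).
    assert (EC : length C1 + length C0 = length C) by apply (cnt_negb q).
    set (Z := length A0 + length Q0 + length C0).
    assert (EZ : cnt negb bs = Z).
    { unfold bs. rewrite <- length_filter_negb. unfold V. rewrite !filter_app, !length_app.
      fold q' A0 Q0 C0. unfold Z. lia. }
    assert (Er1 : rank (length A) bs = length A1) by apply rank_map_prefix.
    assert (Er2 : rank (length A + length Q) bs = length A1 + length Q1).
    { unfold bs, V. rewrite <- length_app, app_assoc, rank_map_prefix, filter_app.
      apply length_app. }
    (* Stability keeps the three pieces contiguous and in order in each half, so [Q] becomes one
       range per half. *)
    assert (EP : part L V = (A0 ++ Q0 ++ C0) ++ (A1 ++ Q1 ++ C1)).
    { unfold part, V. now rewrite !filter_app. }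
    rewrite EP in Hs2.
    assert (Hlen : length A + length Q + length C = n).
    { rewrite <- HV. unfold V. rewrite !length_app. lia. }
    assert (HZ : Z <= n) by (unfold Z; lia).
    assert (Hcon := Hc). destruct Hcon as (H13 & H14 & H15 & H16 & H17 & H18 & H22).
    assert (Hw2 : 4 <= 2 ^ w).
    { destruct Hs as [_ _ _ _ _ Hh _ _]. lia. }
    (* The rank at superblock 0 is 0, so its first word is the number of zeros alone. *)
    assert (Hm0 : m base = Z).
    { transitivity (nth (0 * (K + 2) + 0) (lvl w K f bs) 0).
      { rewrite <- Hs1 by (rewrite Hlvl; lia). f_equal. lia. }
      rewrite (nth_lvl w K f bs 0 0) by lia.
      unfold rank. simpl. rewrite EZ. unfold cnt. simpl. lia. }
    set (bit := Nat.b2n (Nat.testbit t L)).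
    assert (Hbit : t / 2 ^ L mod 2 = bit) by (symmetry; apply Nat.testbit_spec').
    assert (Hbit2 : bit <= 1) by (unfold bit; destruct (Nat.testbit t L); simpl; lia).
    assert (Hdiv := div_le_self t (2 ^ L)).
    (* A level costs two rank calls of [8 * u + 19] steps and at most 9, 7 and 16 instructions
       before, between and after them. *)
    replace (S L * (16 * u + 70) + 1)
      with (9 + (35 + (16 * u + 26) + (L * (16 * u + 70) + 1))) by lia.
    jz_next.
    sub L.
    stp 2.
    stp (t / 2 ^ L).
    stp bit.
    stp Z.
    stp 0.
    stp (length A).
    jmp.
    eapply (reach_seq _ _ (8 * u + 19) (7 + ((8 * u + 19) + (16 + (L * (16 * u + 70) + 1)))));
      [apply (rank_run w K f h u m bs base (length A)); auto; try lia; try (look; lia)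
      |lia|].
    intros [pc1 R1 m1] (Hpc1 & Hm1 & H30 & Hf1). simpl in Hpc1, Hm1, H30, Hf1. subst pc1 m1.
    rewrite EZ, Er1 in H30.
    assert (X22 : R1 22 = 1) by via_frame Hf1.
    assert (X24 : R1 24 = Z) by via_frame Hf1.
    assert (X25 : R1 25 = bit) by via_frame Hf1.
    assert (X26 : R1 26 = length A) by via_frame Hf1.
    assert (X27 : R1 27 = length A + length Q) by via_frame Hf1.
    assert (X29 : R1 29 = 0) by via_frame Hf1.
    assert (X20 : R1 20 = base) by via_frame Hf1.
    assert (X21 : R1 21 = lsz) by via_frame Hf1.
    assert (X6 : R1 6 = t) by via_frame Hf1.
    assert (X9 : R1 9 = c) by via_frame Hf1.
    assert (X12 : R1 12 = L) by via_frame Hf1.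
    assert (X8 : R1 8 = R 8) by (rewrite Hf1 by lia; reflexivity).
    assert (Xc : consts w K f h R1) by (repeat split; via_frame Hf1).
    clear Hf1.
    jz_taken.
    stp (Z + length A1).
    stp (length A + Z).
    (* The subroutine returned [Z] plus the ones before the position; subtracting this from the
       position plus [Z] leaves the zeros before it. *)
    sub (length A0).
    stp (length A + length Q).
    stp 1.
    jmp.
    eapply (reach_seq _ _ (8 * u + 19) (16 + (L * (16 * u + 70) + 1)));
      [apply (rank_run w K f h u m bs base (length A + length Q)); auto; try lia; try (look; lia)
      |lia|].
    intros [pc2 R2 m2] (Hpc2 & Hm2 & Y30 & Hf2). simpl in Hpc2, Hm2, Y30, Hf2. subst pc2 m2.
    rewrite EZ, Er2 in Y30.
    assert (Y4 : R2 4 = Z + length A1) by via_frame Hf2.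
    assert (Y23 : R2 23 = length A0) by via_frame Hf2.
    assert (Y22 : R2 22 = 1) by via_frame Hf2.
    assert (Y24 : R2 24 = Z) by via_frame Hf2.
    assert (Y25 : R2 25 = bit) by via_frame Hf2.
    assert (Y27 : R2 27 = length A + length Q) by via_frame Hf2.
    assert (Y29 : R2 29 = 1) by via_frame Hf2.
    assert (Y20 : R2 20 = base) by via_frame Hf2.
    assert (Y21 : R2 21 = lsz) by via_frame Hf2.
    assert (Y6 : R2 6 = t) by via_frame Hf2.
    assert (Y9 : R2 9 = c) by via_frame Hf2.
    assert (Y12 : R2 12 = L) by via_frame Hf2.
    assert (Y8 : R2 8 = R 8) by (rewrite Hf2 by lia; exact X8).
    assert (Yc : consts w K f h R2).
    { destruct Xc as (? & ? & ? & ? & ? & ? & ?). repeat split; via_frame Hf2. }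
    clear Hf2 Xc H30 H6 H9 H12 H20 H21 H26 H27 X22 X24 X25 X26 X27 X29 X20 X21 X6 X9 X12 X8.
    jz_next.
    jmp.
    stp (length A + length Q + Z).
    sub (length A0 + length Q0).
    stp (base + lsz).
    replace (c + cnt (below (S L) t) Q) with
      (if Nat.testbit t L then c + length Q0 + cnt (below L t) Q1 else c + cnt (below L t) Q0)
      by (rewrite cnt_below_S; unfold Q0, Q1, q', q, cnt; destruct (Nat.testbit t L); lia).
    unfold bit in Y25, Hbit2. destruct (Nat.testbit t L); simpl in Y25.
    + jz_next.
      sub (length Q0).
      stp (c + length Q0).
      stp (Z + length A1).
      stp (Z + (length A1 + length Q1)).
      jmp.
      apply (reach_mono _ _ (L * (16 * u + 70) + 1)); [lia|].
      replace ((A0 ++ Q0 ++ C0) ++ A1 ++ Q1 ++ C1)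
        with ((A0 ++ Q0 ++ C0 ++ A1) ++ Q1 ++ C1) in Hs2 by (now rewrite <- !app_assoc).
      eapply reach_seq with (k2 := 0);
        [apply (IH (A0 ++ Q0 ++ C0 ++ A1) Q1 C1 (base + lsz) (c + length Q0))|lia|];
        rewrite ?length_app; auto; try lia; try (look; lia).
      intros st (? & ? & ? & E8 & ?). apply reach_now. rewrite E8. look. auto.
    + jz_taken.
      stp (length A0).
      stp (length A0 + length Q0).
      jmp.
      apply (reach_mono _ _ (L * (16 * u + 70) + 1)); [lia|].
      replace ((A0 ++ Q0 ++ C0) ++ A1 ++ Q1 ++ C1)
        with (A0 ++ Q0 ++ (C0 ++ A1 ++ Q1 ++ C1)) in Hs2 by (now rewrite <- !app_assoc).
      eapply reach_seq with (k2 := 0);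
        [apply (IH A0 Q0 (C0 ++ A1 ++ Q1 ++ C1) (base + lsz) c)|lia|];
        rewrite ?length_app; auto; try lia; try (look; lia).
      intros st (? & ? & ? & E8 & ?). apply reach_now. rewrite E8. look. auto.
Qed.

(** * The encoding *)

Lemma sorted_nth l : StronglySorted le l ->
  forall a b, a <= b -> b < length l -> nth a l 0 <= nth b l 0.
Proof.
  induction 1 as [|x l H IH F]; intros a b Hab Hb; [simpl in Hb; lia|].
  destruct b as [|b]; [replace a with 0 by lia; lia|].
  simpl in Hb. destruct a as [|a]; simpl.
  - rewrite Forall_forall in F. apply F, nth_In. lia.
  - apply IH; lia.
Qed.

(** Invariant: entries before [lo] are at most [j], entries from [hi] on exceed it. Each of the at
    most [d] halvings takes 10 instructions, the exit 2. *)
Lemma bsearch_run w m F fb j d : 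
  seg m fb F -> StronglySorted le F -> (forall y, In y F -> y < 2 ^ w) ->
  fb + length F < 2 ^ w -> 2 * length F < 2 ^ w ->
  forall lo hi R, R 1 = j -> R 22 = 1 -> R 24 = fb -> R 26 = lo -> R 27 = hi ->
  lo <= hi -> hi <= length F -> hi - lo < 2 ^ d ->
  (forall k, k < lo -> nth k F 0 <= j) ->
  (forall k, hi <= k -> k < length F -> j < nth k F 0) ->
  reach w prog (10 * d + 2) (mkState 47 R m)
    (fun st => pc st = 59 /\ mem st = m /\
       (exists t, regs st 26 = t /\ t <= length F /\ (forall k, k < t -> nth k F 0 <= j) /\
          (forall k, t <= k -> k < length F -> j < nth k F 0)) /\
       forall r, r <> 3 -> r <> 4 -> r <> 26 -> r <> 27 -> regs st r = R r).
Proof.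
  intros Hseg Hsort HF Hfb HlF.
  assert (Exit : forall lo R k, R 1 = j -> R 22 = 1 -> R 24 = fb -> R 26 = lo -> R 27 = lo ->
    lo <= length F -> (forall k, k < lo -> nth k F 0 <= j) ->
    (forall k, lo <= k -> k < length F -> j < nth k F 0) ->
    reach w prog (k + 2) (mkState 47 R m)
    (fun st => pc st = 59 /\ mem st = m /\
       (exists t, regs st 26 = t /\ t <= length F /\ (forall k, k < t -> nth k F 0 <= j) /\
          (forall k, t <= k -> k < length F -> j < nth k F 0)) /\
       forall r, r <> 3 -> r <> 4 -> r <> 26 -> r <> 27 -> regs st r = R r)).
  { intros lo R k H1 H22 H24 H26 H27 Hhi Hlo Hhi2. apply (reach_mono _ _ 2); [lia|].
    sub 0. jz_taken. apply reach_now.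
    split; [reflexivity|]. split; [reflexivity|]. split.
    - exists lo. auto.
    - intros r Hr _ _ _. cbn [regs]. unfold upd. destruct (Nat.eqb_spec r 3); [lia|reflexivity]. }
  induction d as [|d IH]; intros lo hi R H1 H22 H24 H26 H27 Hle Hhi Hd Hlo Hup.
  { simpl in Hd. apply (Exit lo); auto; lia || (intros; apply Hup; lia). }
  destruct (Nat.eq_dec lo hi) as [E|E].
  { replace (10 * S d + 2) with ((10 * d + 10) + 2) by lia. apply (Exit lo); auto; lia || (intros; apply Hup; lia). }
  rewrite Nat.pow_succ_r' in Hd.
  set (mid := (lo + hi) / 2).
  assert (Hmid : lo <= mid < hi /\ mid - lo < 2 ^ d /\ hi - (mid + 1) < 2 ^ d).
  { assert (E2 := Nat.div_mod_eq (lo + hi) 2). assert (B := Nat.mod_upper_bound (lo + hi) 2).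
    fold mid in E2. lia. }
  replace (10 * S d + 2) with (10 + (10 * d + 2)) by lia.
  assert (Hin : nth mid F 0 < 2 ^ w) by (apply HF, nth_In; lia).
  sub (hi - lo).
  jz_next.
  stp (lo + hi).
  stp mid.
  stp (fb + mid).
  stp (nth mid F 0). { apply Hseg. lia. }
  stp (Nat.b2n (j <? nth mid F 0)). { destruct (j <? nth mid F 0); simpl; lia. }
  destruct (Nat.ltb_spec j (nth mid F 0)) as [C|C].
  - jz_next; [discriminate|].
    stp mid.
    jmp.
    eapply reach_seq with (k2 := 0); [apply (IH lo mid); auto; try lia|lia|].
    + intros k Hk Hk2. eapply Nat.lt_le_trans; [exact C|]. now apply sorted_nth.
    + intros st (Hpc & Hm & Ht & Hfr). apply reach_now. repeat split; auto.
      intros r H3 H4 H26' H27'. rewrite Hfr by auto. unfold upd.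
      rewrite !(proj2 (Nat.eqb_neq r _)) by assumption. reflexivity.
  - jz_taken.
    stp (mid + 1).
    jmp.
    apply (reach_mono _ _ (10 * d + 2)); [lia|].
    eapply reach_seq with (k2 := 0); [apply (IH (mid + 1) hi); auto; try lia|lia|].
    + intros k Hk. eapply Nat.le_trans; [|exact C]. apply sorted_nth; auto; lia.
    + intros st (Hpc & Hm & Ht & Hfr). apply reach_now. repeat split; auto.
      intros r H3 H4 H26' H27'. rewrite Hfr by auto. unfold upd.
      rewrite !(proj2 (Nat.eqb_neq r _)) by assumption. reflexivity.
Qed.

(** * Parameters and word layout *)

Definition blk (s : list nat) : nat := alph_size s * S (Nat.log2 (length s)).
(** Enough bits for [blk s] itself, which values and thresholds can both reach. *)
Definition nlev (s : list nat) : nat := S (Nat.log2 (blk s)).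
(** A superblock has [w * fan w] bits, at most [w * w], so [2 * Nat.log2 w + 2] bits hold every
    relative rank. *)
Definition fwd (w : nat) : nat := 2 * Nat.log2 w + 2.
Definition fan (w : nat) : nat := w / fwd w.
(** Half of [log n]: the popcount table has only [O(sqrt n)] entries, yet a word of [O(log n)] bits
    takes [O(1)] lookups. *)
Definition hbits (n : nat) : nat := Nat.log2 n / 2 + 1.

(** The boundary points come in the same order as in [Flist], so an index found there becomes an
    index here by adding [length s]. *)
Definition Vlist (s : list nat) : list nat :=
  map (vpos (blk s) s) (seq 0 (length s)) ++
  flat_map (fun x => map snd (spts (blk s) s x)) (seq 0 (length s / blk s)).
Definition Flist (s : list nat) : list nat :=
  flat_map (fun x => map fst (spts (blk s) s x)) (seq 0 (length s / blk s)).

Definition lsize (w n : nat) : nat := (n / (w * fan w) + 1) * (fan w + 2).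

Definition header (w : nat) (s : list nat) : list nat :=
  let h := hbits (length s) in
  [blk s; alph_size s; nlev s; w * fan w; fan w + 2; w; fwd w; 2 ^ fwd w; 2 ^ h;
   12 + 2 ^ h; 12 + 2 ^ h + length (Flist s); lsize w (length (Vlist s))].

Definition big_words (w : nat) (s : list nat) : list nat :=
  header w s ++ poptable (hbits (length s)) ++ Flist s ++
  levels w (fan w) (fwd w) (nlev s) (Vlist s).

(** Rows and columns start at 0 although queries are 1-indexed, so [(n + 1) * i + j] is the address.
    The quadratic size is harmless, as only [n < 256] uses this table. *)
Definition small_words (s : list nat) : list nat :=
  let n := length s in
  map (fun a => num_distinct (substr s (a / S n) (a mod S n))) (seq 0 (S n * S n)).

Definition encode (w : nat -> nat) (s : list nat) : list bool :=
  bits_of_words (w (length s))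
    (if length s <? 256 then small_words s else big_words (w (length s)) s).

Lemma length_flat_map_const {A} (f : nat -> list A) c l :
  (forall x, length (f x) = c) -> length (flat_map f l) = length l * c.
Proof.
  intros H. induction l as [|x l IH]; simpl; [reflexivity|].
  rewrite length_app, H, IH. lia.
Qed.

Lemma flat_map_split {A} (f : nat -> list A) x N : x < N ->
  flat_map f (seq 0 N) = flat_map f (seq 0 x) ++ f x ++ flat_map f (seq (S x) (N - S x)).
Proof.
  intros H. replace N with (x + S (N - S x)) at 1 by lia.
  rewrite seq_app, flat_map_app. simpl. reflexivity.
Qed.

Lemma length_Flist s : length (Flist s) = length s / blk s * alph_size s.
Proof.
  unfold Flist. rewrite (length_flat_map_const _ (alph_size s)), length_seq; [reflexivity|].
  intros x. rewrite length_map. apply length_spts.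
Qed.

Lemma length_Vlist s : length (Vlist s) = length s + length (Flist s).
Proof.
  rewrite length_Flist. unfold Vlist. rewrite length_app, length_map, length_seq.
  rewrite (length_flat_map_const _ (alph_size s)), length_seq; [reflexivity|].
  intros x. rewrite length_map. apply length_spts.
Qed.

Lemma alph_size_pos s : 0 < length s -> 0 < alph_size s.
Proof.
  intros H. unfold alph_size, num_distinct. destruct s as [|a s]; [simpl in H; lia|].
  assert (Hin : In a (nodup Nat.eq_dec (a :: s))) by (apply nodup_In; now left).
  destruct (nodup Nat.eq_dec (a :: s)); [destruct Hin|simpl; lia].
Qed.

Lemma num_distinct_le l : num_distinct l <= length l.
Proof.
  unfold num_distinct. apply NoDup_incl_length; [apply NoDup_nodup|].
  intros x. apply nodup_In.
Qed.

(** Number of blocks times [sigma * (log n + 1)] is number of blocks times block length: this is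
    what the logarithmic factor in [blk] buys. *)
Lemma Flist_mul_le s : length (Flist s) * S (Nat.log2 (length s)) <= length s.
Proof.
  rewrite length_Flist. rewrite <- Nat.mul_assoc. fold (blk s).
  rewrite Nat.mul_comm. apply Nat.Div0.mul_div_le.
Qed.

Lemma fan_le w : fan w <= w.
Proof. apply div_le_self. Qed.

Lemma fan_fwd_le w : fan w * fwd w <= w.
Proof. unfold fan. rewrite Nat.mul_comm. apply Nat.Div0.mul_div_le. Qed.

Lemma double_lt_pow k : 4 <= k -> 2 * k + 2 < 2 ^ k.
Proof.
  induction 1 as [|k H IH]; [simpl; lia|]. rewrite Nat.pow_succ_r'. lia.
Qed.

(** 18 is [2 * 9], the least word length once [n >= 256]; it also gives [Nat.log2 w >= 4]. *)
Lemma fwd_lt w : 18 <= w -> fwd w < w.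
Proof.
  intros H. assert (H4 : 4 <= Nat.log2 w) by (apply (Nat.log2_le_mono 16 w); lia).
  assert (B := Nat.log2_spec w ltac:(lia)). apply double_lt_pow in H4. unfold fwd. lia.
Qed.

Lemma fan_pos w : 18 <= w -> 1 <= fan w.
Proof.
  intros H. apply fwd_lt in H. unfold fan. apply Nat.div_le_lower_bound; [unfold fwd|]; lia.
Qed.

Lemma fan_fits w : 18 <= w -> w * fan w < 2 ^ fwd w.
Proof.
  intros H. assert (B := Nat.log2_spec w ltac:(lia)). assert (F := fan_le w).
  unfold fwd. replace (2 * Nat.log2 w + 2) with (S (Nat.log2 w) + S (Nat.log2 w)) by lia.
  rewrite Nat.pow_add_r. nia.
Qed.

Lemma lt_pow_log n : n < 2 ^ S (Nat.log2 n).
Proof. destruct n as [|n]; [simpl; lia|]. apply Nat.log2_spec. lia. Qed.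

Lemma blk_pos s : 0 < length s -> 0 < blk s.
Proof. intros H. unfold blk. apply Nat.mul_pos_pos; [now apply alph_size_pos|lia]. Qed.

Lemma blk_lt s : blk s < 2 ^ nlev s.
Proof. apply lt_pow_log. Qed.

(** [sigma <= n] makes the number of levels [O(log n)]. This serves the time bound; the sharp count
    for the main space term is made later with real logarithms. *)
Lemma nlev_le s : nlev s <= 2 * S (Nat.log2 (length s)).
Proof.
  unfold nlev, blk.
  assert (H1 := Nat.log2_mul_above (alph_size s) (S (Nat.log2 (length s))) (Nat.le_0_l _) (Nat.le_0_l _)).
  assert (H2 := Nat.log2_le_mono _ _ (num_distinct_le s)).
  assert (H3 := Nat.log2_lt_lin (S (Nat.log2 (length s))) ltac:(lia)).
  unfold alph_size in *. lia.
Qed.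

Lemma hbits_le n : 256 <= n -> hbits n <= Nat.log2 n.
Proof.
  intros H. assert (H8 : 8 <= Nat.log2 n) by (apply (Nat.log2_le_mono 256); lia).
  unfold hbits. assert (E := Nat.div_mod_eq (Nat.log2 n) 2). lia.
Qed.

Lemma log2_large n : 256 <= n -> 9 <= S (Nat.log2 n).
Proof. intros H. apply (Nat.log2_le_mono 256) in H. change (Nat.log2 256) with 8 in H. lia. Qed.

Lemma square_lt_pow k : 9 <= k -> k * k + 2 * k + 12 <= 2 ^ (k - 1).
Proof.
  induction 1 as [|k H IH]; [simpl; lia|].
  replace (S k - 1) with (S (k - 1)) by lia. rewrite Nat.pow_succ_r'. nia.
Qed.

(** Coarse, by [fan w + 2 <= 3 * fan w]: good enough for addresses, not for the space bound. *)
Lemma lsize_mul_le w n : 18 <= w -> w * lsize w n <= 3 * n + w * (w + 2).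
Proof.
  intros H. assert (HK := fan_pos w H). assert (HK2 := fan_le w). unfold lsize.
  assert (D := Nat.Div0.mul_div_le n (w * fan w)).
  set (q := n / (w * fan w)) in *.
  assert (w * (q * (fan w + 2)) <= 3 * n) by nia. nia.
Qed.

(** All addresses fit into a word. The table and [Flist] have at most [n] words each, and the at
    most [w] levels over at most [2 * n] values add [6 * n + w * (w + 2)]; hence the 8. *)
Lemma size_bound w s : 256 <= length s -> 2 * S (Nat.log2 (length s)) <= w ->
  12 + 2 ^ hbits (length s) + length (Flist s) + nlev s * lsize w (length (Vlist s)) < 2 ^ w /\
  8 * length s < 2 ^ (w - 1).
Proof.
  intros Hn Hw. assert (Hg := log2_large _ Hn).
  assert (Hh := hbits_le _ Hn). assert (HF := Flist_mul_le s).
  assert (HV := length_Vlist s). assert (HL := nlev_le s).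
  set (g := S (Nat.log2 (length s))) in *.
  assert (HF2 : length (Flist s) <= length s) by nia.
  assert (Hls := lsize_mul_le w (length (Vlist s)) ltac:(lia)).
  assert (H1 : nlev s * lsize w (length (Vlist s)) <= w * lsize w (length (Vlist s)))
    by (apply Nat.mul_le_mono_r; lia).
  assert (H2 : 2 ^ hbits (length s) <= length s).
  { transitivity (2 ^ Nat.log2 (length s)); [apply Nat.pow_le_mono_r; lia|].
    apply Nat.log2_spec. lia. }
  assert (H3 : 8 * length s < 2 ^ (w - 1)).
  { apply Nat.lt_le_trans with (2 ^ (3 + g)).
    - rewrite Nat.pow_add_r. assert (B := lt_pow_log (length s)). fold g in B. simpl (2 ^ 3). lia.
    - apply Nat.pow_le_mono_r; lia. }
  assert (H4 := square_lt_pow w ltac:(lia)).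
  assert (H5 : 2 ^ w = 2 * 2 ^ (w - 1)).
  { rewrite <- Nat.pow_succ_r'. f_equal. lia. }
  split; [|exact H3]. lia.
Qed.

Lemma below_small L t v : v < 2 ^ L -> t < 2 ^ L -> below L t v = (v <? t).
Proof. intros H1 H2. unfold below. now rewrite !Nat.mod_small. Qed.

Lemma Vlist_le s v : 0 < length s -> In v (Vlist s) -> v <= blk s.
Proof.
  intros Hs Hv. apply in_app_iff in Hv. destruct Hv as [Hv|Hv].
  - apply in_map_iff in Hv. destruct Hv as [k [<- _]]. apply vpos_le. now apply blk_pos.
  - apply in_flat_map in Hv. destruct Hv as [x [_ Hv]]. apply in_map_iff in Hv.
    destruct Hv as [p [<- Hp]]. eapply spts_snd_le. exact Hp.
Qed.

Lemma Flist_le s y : 0 < length s -> In y (Flist s) -> y <= length s.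
Proof.
  intros Hs Hy. apply in_flat_map in Hy. destruct Hy as [x [Hx Hy]]. apply in_seq in Hx.
  apply in_map_iff in Hy. destruct Hy as [p [<- Hp]].
  apply (spts_fst_le (blk s) s x); [|exact Hp].
  assert (D := Nat.Div0.mul_div_le (length s) (blk s)). nia.
Qed.

Lemma header_length w s : length (header w s) = 12.
Proof. reflexivity. Qed.

Lemma length_big_words w s : length (big_words w s) =
  12 + 2 ^ hbits (length s) + length (Flist s) + nlev s * lsize w (length (Vlist s)).
Proof.
  unfold big_words. rewrite !length_app, header_length, length_poptable, length_levels.
  unfold lsize. lia.
Qed.

Lemma big_words_lt w s : 256 <= length s -> 2 * S (Nat.log2 (length s)) <= w ->
  forall x, In x (big_words w s) -> x < 2 ^ w.
Proof.
  intros Hn Hw x Hx. assert (Hg := log2_large _ Hn).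
  destruct (size_bound w s Hn Hw) as [HS H8].
  assert (Hw18 : 18 <= w) by lia.
  assert (Hp : 2 ^ (w - 1) <= 2 ^ w) by (apply Nat.pow_le_mono_r; lia).
  assert (Hww := square_lt_pow w ltac:(lia)).
  assert (HF := Flist_mul_le s). assert (HV := length_Vlist s).
  assert (HF2 : length (Flist s) <= length s) by nia.
  assert (F1 := fan_fits w Hw18). assert (F2 := fwd_lt w Hw18). assert (F3 := fan_pos w Hw18).
  assert (F4 := fan_fwd_le w). assert (F5 := fan_le w).
  assert (Hfw : 2 ^ fwd w < 2 ^ w) by (apply Nat.pow_lt_mono_r; lia).
  assert (HL := nlev_le s).
  assert (Hlsz : lsize w (length (Vlist s)) < 2 ^ w).
  { assert (P := Nat.mul_le_mono_r 1 (nlev s) (lsize w (length (Vlist s))) ltac:(unfold nlev; lia)). lia. }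
  assert (Ha := num_distinct_le s). fold (alph_size s) in Ha.
  assert (Hb : blk s < 2 ^ w).
  { eapply Nat.lt_le_trans; [apply blk_lt|]. apply Nat.pow_le_mono_r; lia. }
  unfold big_words in Hx. rewrite !in_app_iff in Hx.
  destruct Hx as [Hx|[Hx|[Hx|Hx]]].
  - unfold header in Hx. cbn [In] in Hx.
    repeat (destruct Hx as [<-|Hx]; [clear - Hww Hp H8 Ha HS Hb HL Hw F1 F2 Hfw F5 Hlsz Hn; lia|]).
    destruct Hx.
  - unfold poptable in Hx. apply in_map_iff in Hx. destruct Hx as [y [<- _]].
    assert (P := popcount_le (hbits (length s)) y). assert (B := hbits_le _ Hn). lia.
  - apply Flist_le in Hx; lia.
  - eapply levels_lt; [exact F1|exact F4| |exact Hx]. lia.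
Qed.

(** [2 * hbits n] is at least [log n + 1], so [2 * c] table lookups cover a word. *)
Lemma sane_big w c (s : list nat) m : 256 <= length s -> 2 * S (Nat.log2 (length s)) <= w ->
  w <= c * S (Nat.log2 (length s)) -> seg m 12 (poptable (hbits (length s))) ->
  sane w (fan w) (fwd w) (hbits (length s)) (2 * c) m.
Proof.
  intros Hn Hw Hc Hm. assert (Hg := log2_large _ Hn).
  destruct (size_bound w s Hn Hw) as [HS _].
  constructor; try lia.
  - apply fan_pos. lia.
  - apply fan_fwd_le.
  - apply fwd_lt. lia.
  - apply fan_fits. lia.
  - unfold hbits. assert (E := Nat.div_mod_eq (Nat.log2 (length s)) 2).
    assert (B := Nat.mod_upper_bound (Nat.log2 (length s)) 2). nia.
  - exact Hm.
Qed.

(** * Correctness and running time of a whole query *)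

Definition fbase (s : list nat) : nat := 12 + 2 ^ hbits (length s).
Definition lbase (s : list nat) : nat := fbase s + length (Flist s).

Definition ready (w : nat) (s : list nat) (i j : nat) (R : nat -> nat) : Prop :=
  R 0 = i /\ R 1 = j /\ R 2 = length s /\ R 10 = blk s /\ R 11 = alph_size s /\ R 12 = nlev s /\
  R 19 = fbase s /\ R 20 = lbase s /\ R 21 = lsize w (length (Vlist s)) /\
  consts w (fan w) (fwd w) (hbits (length s)) R.

Ltac halve n k :=
  stp (n / 2 ^ k);
  [rewrite Nat.Div0.div_div; reflexivity | eapply Nat.le_lt_trans; [apply div_le_self|assumption] |].

Lemma prologue w s i j m R :
  256 <= length s -> 2 * S (Nat.log2 (length s)) <= w ->
  (forall k, m k = nth k (big_words w s) 0) ->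
  R 0 = i -> R 1 = j -> R 2 = length s ->
  reach w prog 34 (mkState 0 R m) (fun st => pc st = 34 /\ mem st = m /\ ready w s i j (regs st)).
Proof.
  intros Hn Hw Hm H0 H1 H2. set (n := length s) in *.
  assert (Hg := log2_large _ Hn).
  assert (Hall : forall k, m k < 2 ^ w).
  { intros k. rewrite Hm. destruct (Nat.lt_ge_cases k (length (big_words w s))) as [C|C].
    - apply (big_words_lt w s Hn Hw). now apply nth_In.
    - rewrite nth_overflow by exact C. apply pow2_pos. }
  assert (Hnw : n < 2 ^ w).
  { eapply Nat.lt_le_trans; [apply lt_pow_log|]. apply Nat.pow_le_mono_r; lia. }
  assert (Hw12 : 2 ^ 4 <= 2 ^ w) by (apply Nat.pow_le_mono_r; lia). simpl (2 ^ 4) in Hw12.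
  assert (E0 : m 0 = blk s) by (now rewrite Hm).
  assert (E1 : m 1 = alph_size s) by (now rewrite Hm).
  assert (E2 : m 2 = nlev s) by (now rewrite Hm).
  assert (E3 : m 3 = w * fan w) by (now rewrite Hm).
  assert (E4 : m 4 = fan w + 2) by (now rewrite Hm).
  assert (E5 : m 5 = w) by (now rewrite Hm).
  assert (E6 : m 6 = fwd w) by (now rewrite Hm).
  assert (E7 : m 7 = 2 ^ fwd w) by (now rewrite Hm).
  assert (E8 : m 8 = 2 ^ hbits n) by (now rewrite Hm).
  assert (E9 : m 9 = fbase s) by (now rewrite Hm).
  assert (E10 : m 10 = lbase s) by (now rewrite Hm).
  assert (E11 : m 11 = lsize w (length (Vlist s))) by (now rewrite Hm).
  clear Hm.
  stp 1.
  stp (n / 2 ^ 1); [eapply Nat.le_lt_trans; [apply div_le_self|assumption]|].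
  halve n 2. halve n 3. halve n 4. halve n 5. halve n 6. halve n 7. halve n 8.
  jz_next.
  { change (2 ^ 8) with 256. intros E. apply Nat.div_small_iff in E; lia. }
  stp 0. stp (blk s); [rewrite <- E0; apply Hall|].
  stp 1. stp (alph_size s); [rewrite <- E1; apply Hall|].
  stp 2. stp (nlev s); [rewrite <- E2; apply Hall|].
  stp 3. stp (w * fan w); [rewrite <- E3; apply Hall|].
  stp 4. stp (fan w + 2); [rewrite <- E4; apply Hall|].
  stp 5. stp w; [apply Nat.pow_gt_lin_r; lia|].
  stp 6. stp (fwd w); [rewrite <- E6; apply Hall|].
  stp 7. stp (2 ^ fwd w); [rewrite <- E7; apply Hall|].
  stp 8. stp (2 ^ hbits n); [rewrite <- E8; apply Hall|].
  stp 9. stp (fbase s); [rewrite <- E9; apply Hall|].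
  stp 10. stp (lbase s); [rewrite <- E10; apply Hall|].
  stp 11. stp (lsize w (length (Vlist s))); [rewrite <- E11; apply Hall|].
  apply reach_now. split; [reflexivity|]. split; [reflexivity|].
  repeat split; look; reflexivity || assumption.
Qed.

(** Register 8 is both flag and minuend: 0 if present characters were counted, [sigma] if absent
    ones were. *)
Lemma finish w m R b c ans : R 22 = 1 -> R 8 = b -> R 9 = c -> b < 2 ^ w -> c < 2 ^ w ->
  (b = 0 /\ ans = c \/ b <> 0 /\ ans + c = b) ->
  reach w prog 3 (mkState 94 R m) (fun st => halted prog st = true /\ regs st 0 = ans).
Proof.
  intros H22 H8 H9 Hb Hc Hans. destruct (Nat.eq_dec b 0) as [E|E].
  - jz_taken. stp ans. apply reach_now. split; reflexivity.
  - jz_next. sub ans. stp ans. apply reach_now. split; reflexivity.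
Qed.

Definition loaded (w : nat) (s : list nat) (m : nat -> nat) : Prop :=
  seg m 12 (poptable (hbits (length s))) /\ seg m (fbase s) (Flist s) /\
  seg m (lbase s) (levels w (fan w) (fwd w) (nlev s) (Vlist s)).

Lemma count_finish w c s m R A Q C t b ans :
  256 <= length s -> 2 * S (Nat.log2 (length s)) <= w -> w <= c * S (Nat.log2 (length s)) ->
  loaded w s m -> Vlist s = A ++ Q ++ C -> t <= blk s ->
  consts w (fan w) (fwd w) (hbits (length s)) R ->
  R 6 = t -> R 8 = b -> R 9 = 0 -> R 12 = nlev s -> R 20 = lbase s ->
  R 21 = lsize w (length (Vlist s)) -> R 26 = length A -> R 27 = length A + length Q ->
  b <= alph_size s ->
  (let k := cnt (fun v => v <? t) Q in b = 0 /\ ans = k \/ b <> 0 /\ ans + k = b) ->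
  reach w prog (nlev s * (32 * c + 70) + 4) (mkState 67 R m)
    (fun st => halted prog st = true /\ regs st 0 = ans).
Proof.
  intros Hn Hw Hc (Htab & _ & Hlev) HV Ht Hcon H6 H8 H9 H12 H20 H21 H26 H27 Hb Hans.
  destruct (size_bound w s Hn Hw) as [HS H8n].
  assert (Hg := log2_large _ Hn).
  assert (Hp : 2 ^ (w - 1) <= 2 ^ w) by (apply Nat.pow_le_mono_r; lia).
  assert (HF := Flist_mul_le s). assert (HlV := length_Vlist s).
  assert (HF2 : length (Flist s) <= length s) by nia.
  assert (HQ : length Q <= length (Vlist s)) by (rewrite HV, !length_app; lia).
  assert (HL := nlev_le s). assert (Hww : w < 2 ^ w) by (apply Nat.pow_gt_lin_r; lia).
  assert (Ha := num_distinct_le s). fold (alph_size s) in Ha.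
  assert (HB := blk_lt s).
  assert (Hbw : 2 ^ nlev s <= 2 ^ w) by (apply Nat.pow_le_mono_r; lia).
  assert (Ecnt : cnt (below (nlev s) t) Q = cnt (fun v => v <? t) Q).
  { apply cnt_ext. intros v Hv. apply below_small; [|lia].
    eapply Nat.le_lt_trans; [|exact HB]. apply Vlist_le; [lia|].
    rewrite HV. apply in_or_app. right. apply in_or_app. now left. }
  eapply reach_seq;
    [apply (loop_run w (fan w) (fwd w) (hbits (length s)) (2 * c) m t
              (lsize w (length (Vlist s))) (length (Vlist s))
              (sane_big w c s m Hn Hw Hc Htab)) with (A := A) (Q := Q) (C := C)
              (base := lbase s) (c := 0) (L := nlev s)| |].
  - lia.
  - lia.
  - reflexivity.
  - now rewrite HV.
  - exact Hcon.
  - exact H6.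
  - exact H9.
  - exact H12.
  - exact H20.
  - exact H21.
  - exact H26.
  - exact H27.
  - now rewrite <- HV.
  - unfold lbase, fbase. lia.
  - lia.
  - lia.
  - instantiate (1 := 3). lia.
  - intros [pc' R' m'] (Hpc & Hm & Y9 & Y8 & Y22). simpl in Hpc, Hm, Y9, Y8, Y22. subst pc' m'.
    assert (Hcb := cnt_le (fun v => v <? t) Q).
    apply (finish w m R' b (cnt (fun v => v <? t) Q)); auto; try lia.
Qed.

Lemma cut3 {A} (l : list A) a b : l = firstn a l ++ firstn b (skipn a l) ++ skipn b (skipn a l).
Proof. now rewrite !firstn_skipn. Qed.

Lemma firstn_seq k a n : k <= n -> firstn k (seq a n) = seq a k.
Proof.
  intros H. replace n with (k + (n - k)) by lia.
  rewrite seq_app, firstn_app, length_seq, Nat.sub_diag, firstn_O, app_nil_r.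
  apply firstn_all2. now rewrite length_seq.
Qed.

Lemma main_run w c s i j m R :
  256 <= length s -> 2 * S (Nat.log2 (length s)) <= w -> w <= c * S (Nat.log2 (length s)) ->
  loaded w s m -> ready w s (S i) (S j) R -> i <= j -> j < length s ->
  reach w prog (10 * S (Nat.log2 (length s)) + nlev s * (32 * c + 70) + 30) (mkState 34 R m)
    (fun st => halted prog st = true /\
               regs st 0 = num_distinct (firstn (S j - i) (skipn i s))).
Proof.
  intros Hn Hw Hc Hload (H0 & H1 & H2 & H10 & H11 & H12 & H19 & H20 & H21 & Hcon) Hij Hj.
  destruct (size_bound w s Hn Hw) as [HS H8n].
  assert (Hg := log2_large _ Hn).
  assert (Hp : 2 ^ (w - 1) <= 2 ^ w) by (apply Nat.pow_le_mono_r; lia).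
  assert (HF := Flist_mul_le s). assert (HlV := length_Vlist s).
  assert (HF2 : length (Flist s) <= length s) by nia.
  assert (Ha := num_distinct_le s). fold (alph_size s) in Ha.
  assert (HB : 0 < blk s) by (apply blk_pos; lia).
  set (B := blk s) in *.
  assert (Hcon' := Hcon). destruct Hcon' as (_ & _ & _ & _ & _ & _ & H22).
  assert (Dj := div_le_self j B). assert (Di : i / B <= j / B) by (now apply Nat.Div0.div_le_mono).
  assert (Mi := Nat.mod_upper_bound i B ltac:(lia)).
  assert (Mi2 := Nat.Div0.mod_le i B).
  replace (10 * S (Nat.log2 (length s)) + nlev s * (32 * c + 70) + 30)
    with (9 + (5 + ((10 * S (Nat.log2 (length s)) + 2) + 5 + (nlev s * (32 * c + 70) + 4) + 5))) by lia.
  sub i. sub j.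
  stp (i / B).
  stp (i mod B).
  stp (i mod B + 1).
  stp (j / B).
  sub (j / B - i / B).
  stp 0.
  rewrite Nat.add_1_r.
  destruct (Nat.eq_dec (i / B) (j / B)) as [E|E].
  - jz_taken.
    apply (reach_mono _ _ (3 + (nlev s * (32 * c + 70) + 4))); [lia|].
    stp i. stp (j + 1). stp 0.
    assert (EQ : firstn (S j - i) (skipn i (Vlist s)) = map (vpos B s) (seq i (S j - i))).
    { unfold Vlist. rewrite skipn_app, length_map, length_seq.
      replace (i - length s) with 0 by lia. simpl skipn at 2.
      rewrite firstn_app, skipn_map, skipn_seq, length_map, length_seq.
      replace (S j - i - (length s - i)) with 0 by lia. simpl firstn at 2.
      now rewrite app_nil_r, firstn_map, firstn_seq by lia. }
    eapply (count_finish w c s m _ (firstn i (Vlist s)) (firstn (S j - i) (skipn i (Vlist s)))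
             (skipn (S j - i) (skipn i (Vlist s))) (S (i mod B)) 0); auto.
    + apply cut3.
    + look. rewrite length_firstn. lia.
    + look. rewrite length_firstn, length_map, length_seq. lia.
    + lia.
    + left. split; [reflexivity|]. rewrite EQ, cnt_map. symmetry. now apply same_block_count.
  - jz_next.
    set (x := i / B) in *.
    (* As [j] lies in a later block, block [x] is complete and its boundary is stored. *)
    assert (Hx : x < length s / B).
    { eapply Nat.lt_le_trans with (j / B); [lia|]. apply Nat.Div0.div_le_mono. lia. }
    set (sg := alph_size s) in *.
    assert (HFl : length (Flist s) = length s / B * sg) by apply length_Flist.
    assert (Hxs : x * sg + sg <= length (Flist s)) 
      by (assert (X := Nat.mul_le_mono_r (S x) _ sg Hx); rewrite HFl; lia).
    stp (x * sg).
    stp (fbase s + x * sg). { unfold fbase. lia. }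
    stp 0. stp sg.
    set (P := spts B s x). set (F := map fst P).
    assert (HlF : length F = sg) by (unfold F; rewrite length_map; apply length_spts).
    set (pre := flat_map (fun x => map fst (spts B s x)) (seq 0 x)).
    set (preV := flat_map (fun x => map snd (spts B s x)) (seq 0 x)).
    assert (Hpre : length pre = x * sg).
    { unfold pre. rewrite (length_flat_map_const _ sg), length_seq; [reflexivity|].
      intros y. rewrite length_map. apply length_spts. }
    assert (HpreV : length preV = x * sg).
    { unfold preV. rewrite (length_flat_map_const _ sg), length_seq; [reflexivity|].
      intros y. rewrite length_map. apply length_spts. }
    assert (HsegF : seg m (fbase s + x * sg) F).
    { destruct Hload as (_ & Hs & _). unfold Flist in Hs. fold B in Hs.
      rewrite (flat_map_split _ x) in Hs by exact Hx. apply seg_app in Hs. destruct Hs as [_ Hs].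
      fold pre in Hs. rewrite Hpre in Hs. now apply seg_app in Hs. }
    assert (HFin : forall y, In y F -> y <= length s).
    { intros y Hy. apply Flist_le; [lia|]. unfold Flist. fold B.
      rewrite (flat_map_split _ x) by exact Hx. apply in_or_app. right. apply in_or_app. now left. }
    assert (Hd : sg < 2 ^ S (Nat.log2 (length s))).
    { eapply Nat.le_lt_trans; [exact Ha|apply lt_pow_log]. }
    apply (reach_mono _ _ ((10 * S (Nat.log2 (length s)) + 2) + (5 + (nlev s * (32 * c + 70) + 4))));
      [lia|].
    eapply reach_seq.
    { apply (bsearch_run w m F (fbase s + x * sg) j (S (Nat.log2 (length s))) HsegF
              (spts_sorted B s x)) with (lo := 0) (hi := sg); auto.
      all: try (unfold fbase; lia); try (intros; lia).
      intros y Hy. apply HFin in Hy. lia. }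
    { apply Nat.le_refl. }
    intros [pc' R' m'] (Hpc & Hm & (t & Y26 & Ht & Hlo & Hup) & Hfr).
    simpl in Hpc, Hm, Y26, Hfr. subst pc' m'.
    assert (Y2 : R' 2 = length s) by (rewrite Hfr by lia; look; reflexivity).
    assert (Y6 : R' 6 = S (i mod B)) by (rewrite Hfr by lia; look; reflexivity).
    assert (Y7 : R' 7 = x * sg) by (rewrite Hfr by lia; look; reflexivity).
    assert (Y9 : R' 9 = 0) by (rewrite Hfr by lia; look; reflexivity).
    assert (Y11 : R' 11 = sg) by (rewrite Hfr by lia; look; reflexivity).
    assert (Y12 : R' 12 = nlev s) by (rewrite Hfr by lia; look; reflexivity).
    assert (Y20 : R' 20 = lbase s) by (rewrite Hfr by lia; look; reflexivity).
    assert (Y21 : R' 21 = lsize w (length (Vlist s))) by (rewrite Hfr by lia; look; reflexivity).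
    assert (Y22 : R' 22 = 1) by (rewrite Hfr by lia; look; reflexivity).
    assert (Yc : consts w (fan w) (fwd w) (hbits (length s)) R').
    { destruct Hcon as (? & ? & ? & ? & ? & ? & ?).
      repeat split; rewrite Hfr by lia; look; reflexivity. }
    clear Hfr.
    stp (length s + x * sg).
    stp (t + (length s + x * sg)).
    stp (length s + x * sg + sg).
    stp sg.
    jmp.
    assert (Hsg : 0 < sg) by (apply alph_size_pos; lia).
    set (G := map snd P).
    assert (HlG : length G = sg) by (unfold G; rewrite length_map; apply length_spts).
    (* Skipped in [Vlist] are the [n] links, the points of earlier boundaries, and the [t] points of
       this one whose position is at most [j]. *)
    eapply (count_finish w c s m _
      ((map (vpos B s) (seq 0 (length s)) ++ preV) ++ firstn t G) (skipn t G)
      (flat_map (fun x => map snd (spts B s x)) (seq (S x) (length s / B - S x)))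
      (S (i mod B)) sg); auto.
    + unfold Vlist. fold B. rewrite (flat_map_split _ x) by exact Hx. fold preV.
      change (map snd (spts B s x)) with G.
      rewrite <- !app_assoc, (app_assoc (firstn t G)), firstn_skipn. reflexivity.
    + look. rewrite !length_app, length_map, length_seq, HpreV, length_firstn. lia.
    + look. rewrite !length_app, length_map, length_seq, HpreV, length_firstn, length_skipn. lia.
    + right. split; [lia|]. cbv zeta.
      assert (X := cross_block_count B s i j HB Hij Hj ltac:(lia)). fold x in X.
      rewrite (cnt_perm _ _ _ (spts_perm B s x)) in X.
      rewrite (cnt_suffix _ j _ t) in X; [fold P G sg in X; lia| | |].
      * rewrite length_spts. fold sg. lia.
      * exact Hlo.
      * rewrite length_spts. fold sg. rewrite <- HlF. exact Hup.
Qed.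

Lemma substr_distinct_le s i j : num_distinct (substr s i j) <= length s.
Proof.
  etransitivity; [apply num_distinct_le|]. unfold substr.
  rewrite length_firstn, length_skipn. lia.
Qed.

(** The factor 2 in the word length pays for the addresses of the quadratic table. *)
Lemma square_le_pow w n : 2 * S (Nat.log2 n) <= w -> S n * S n <= 2 ^ w.
Proof.
  intros H. assert (B := lt_pow_log n). transitivity (2 ^ (2 * S (Nat.log2 n))).
  - replace (2 * S (Nat.log2 n)) with (S (Nat.log2 n) + S (Nat.log2 n)) by lia.
    rewrite Nat.pow_add_r. apply Nat.mul_le_mono; lia.
  - apply Nat.pow_le_mono_r; lia.
Qed.

Lemma small_run w s i j m R : length s < 256 -> 2 * S (Nat.log2 (length s)) <= w ->
  (forall k, m k = nth k (small_words s) 0) ->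
  R 0 = i -> R 1 = j -> R 2 = length s -> 1 <= i -> i <= j -> j <= length s ->
  reach w prog 14 (mkState 0 R m)
    (fun st => halted prog st = true /\ regs st 0 = num_distinct (substr s i j)).
Proof.
  intros Hn Hw Hm H0 H1 H2 Hi Hij Hj. set (n := length s) in *.
  assert (Hsq := square_le_pow w n Hw).
  assert (Hnw : n < 2 ^ w) by nia.
  assert (Hnw1 : n + 1 < 2 ^ w) by nia.
  assert (Hd := substr_distinct_le s i j). fold n in Hd.
  assert (Hidx : (n + 1) * i + j < S n * S n) by nia.
  assert (Hrow : (n + 1) * i < 2 ^ w) by lia.
  assert (Hval : m ((n + 1) * i + j) = num_distinct (substr s i j)).
  { rewrite Hm. unfold small_words. fold n. rewrite nth_map_seq by exact Hidx.
    rewrite Nat.add_1_r, (Nat.mul_comm (S n)), Nat.div_add_l, Nat.div_small, Nat.add_0_r by lia.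
    rewrite Nat.add_comm, Nat.Div0.mod_add, Nat.mod_small by lia. reflexivity. }
  clear Hm.
  stp 1.
  stp (n / 2 ^ 1); [eapply Nat.le_lt_trans; [apply div_le_self|assumption]|].
  (* The test for [n < 256] shifts by 1 eight times because for tiny [n] a word may have only 2
     bits, too few for the constants 256 or 8. *)
  halve n 2. halve n 3. halve n 4. halve n 5. halve n 6. halve n 7. halve n 8.
  jz_taken. { change (2 ^ 8) with 256. now apply Nat.div_small. }
  stp (n + 1).
  stp ((n + 1) * i).
  stp ((n + 1) * i + j).
  stp (num_distinct (substr s i j)).
  apply reach_now. split; reflexivity.
Qed.

Lemma small_words_lt w s : 2 * S (Nat.log2 (length s)) <= w ->
  forall x, In x (small_words s) -> x < 2 ^ w.
Proof.
  intros H x Hx. apply in_map_iff in Hx. destruct Hx as [a [<- _]].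
  assert (B := square_le_pow w _ H).
  assert (D := substr_distinct_le s (a / S (length s)) (a mod S (length s))). nia.
Qed.

Lemma loaded_big w s m : (forall k, m k = nth k (big_words w s) 0) -> loaded w s m.
Proof.
  intros Hm.
  assert (H : seg m 0 (big_words w s)) by (intros k _; apply Hm).
  unfold big_words in H. apply seg_app in H. destruct H as [_ H].
  apply seg_app in H. destruct H as [H1 H]. apply seg_app in H. destruct H as [H2 H3].
  rewrite header_length, length_poptable in *. repeat split; assumption.
Qed.

(** The main term is at most [2 * S (Nat.log2 n)] levels of [32 * c + 70] steps; the rest of the
    constant absorbs the binary search and the fixed blocks. *)
Lemma query (w : nat -> nat) c s i j :
  2 * S (Nat.log2 (length s)) <= w (length s) -> w (length s) <= c * S (Nat.log2 (length s)) ->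
  1 <= i -> i <= j -> j <= length s ->
  reach (w (length s)) prog ((64 * c + 250) * S (Nat.log2 (length s)))
    (init_state (w (length s)) (encode w s) (length s) i j)
    (fun st => halted prog st = true /\ regs st 0 = num_distinct (substr s i j)).
Proof.
  intros Hw Hc Hi Hij Hj. unfold init_state, encode.
  set (R := fun r => _). set (w0 := w (length s)) in *.
  destruct (Nat.ltb_spec (length s) 256) as [Hn|Hn].
  - apply (reach_mono _ _ 14); [nia|].
    apply small_run; auto. intros k. apply init_mem_words. now apply small_words_lt.
  - set (m := init_mem _ _).
    assert (Hm : forall k, m k = nth k (big_words w0 s) 0)
      by (intros k; apply init_mem_words; now apply big_words_lt).
    assert (HL := nlev_le s).
    eapply reach_seq with
      (k2 := 10 * S (Nat.log2 (length s)) + nlev s * (32 * c + 70) + 30).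
    + apply (prologue w0 s i j m R); auto.
    + nia.
    + intros [pc' R' m'] (Hpc & Hm' & Hr). simpl in Hpc, Hm', Hr. subst pc' m'.
      replace i with (S (i - 1)) in Hr by lia. replace j with (S (j - 1)) in Hr by lia.
      assert (X := main_run w0 c s (i - 1) (j - 1) m R' Hn Hw Hc (loaded_big _ _ _ Hm) Hr
                     ltac:(lia) ltac:(lia)).
      unfold substr. now replace (j - i + 1) with (S (j - 1) - (i - 1)) by lia.
Qed.

(** * Space *)

From Stdlib Require Import Reals Lra.
Open Scope nat_scope.

Lemma square_le_four_pow k : S k * S k <= 4 * 2 ^ k.
Proof.
  destruct (Nat.le_gt_cases k 2) as [H|H].
  - destruct k as [|[|[|k]]]; simpl; lia.
  - induction H as [|k H IH]; [simpl; lia|]. rewrite Nat.pow_succ_r'. nia.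
Qed.

(** Each of the [O(log n)] levels may waste one superblock of [O(log n * log n)] bits; this makes
    the waste [O(n)]. *)
Lemma cube_le_pow k : S k * S k * S k <= 8 * 2 ^ k.
Proof.
  destruct (Nat.le_gt_cases k 3) as [H|H].
  - destruct k as [|[|[|[|k]]]]; simpl; lia.
  - induction H as [|k H IH]; [simpl; lia|]. rewrite Nat.pow_succ_r'. nia.
Qed.

(** With [l = log2 w], combine [(l + 1) * (l + 1) / 4 <= w] and [w < 2 * (l + 1) * (fan w + 1)]. The
    true order of [fan w] is larger, but a directory overhead of [n / log log n] per level
    suffices. *)
Lemma fan_large w : 18 <= w -> S (Nat.log2 w) <= 16 * fan w.
Proof.
  intros H. assert (HK := fan_pos w H).
  assert (Hlt : w < fwd w * S (fan w)) by (apply Nat.mul_succ_div_gt; unfold fwd; lia).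
  assert (B := Nat.log2_spec w ltac:(lia)). assert (S4 := square_le_four_pow (Nat.log2 w)).
  unfold fwd in Hlt. set (l := Nat.log2 w) in *. nia.
Qed.

Lemma table_size n : 1 <= n -> S (Nat.log2 n) * 2 ^ hbits n <= 16 * n.
Proof.
  intros H. assert (B := Nat.log2_spec n ltac:(lia)). unfold hbits.
  set (k := Nat.log2 n) in *. assert (E := Nat.div_mod_eq k 2).
  assert (M := Nat.mod_upper_bound k 2 ltac:(lia)). set (e := k / 2) in *.
  assert (P : 2 ^ k = 2 ^ e * 2 ^ (k - e)) by (rewrite <- Nat.pow_add_r; f_equal; lia).
  assert (Q : 2 ^ e <= 2 ^ (k - e)) by (apply Nat.pow_le_mono_r; lia).
  assert (G := Nat.pow_gt_lin_r 2 e ltac:(lia)).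
  rewrite Nat.add_1_r, Nat.pow_succ_r'.
  assert (S k <= 8 * 2 ^ (k - e)) by lia.
  transitivity (16 * 2 ^ k); [|lia]. rewrite P. nia.
Qed.

(** [E] is the overhead paid on every level: the boundary points and two directory words per
    superblock. Its 65 is 1 for the points plus [2 * 16 * 2] for the directories. The rest is [O(n)]
    in total: 12, 16 and 1 for header, table and [Flist], and [48 = 2 * 3 * 8] for the last
    superblocks. *)
Lemma length_encode_le w c s : 256 <= length s ->
  2 * S (Nat.log2 (length s)) <= w (length s) -> w (length s) <= c * S (Nat.log2 (length s)) ->
  exists E, S (Nat.log2 (S (Nat.log2 (length s)))) * E <= 65 * length s /\
  length (encode w s) <= nlev s * (length s + E) + (29 * c + 48 * c * c) * length s.
Proof.
  intros Hn Hw Hc. unfold encode. rewrite length_bits_of_words.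
  destruct (Nat.ltb_spec (length s) 256) as [H|_]; [lia|].
  rewrite length_big_words. set (v := w (length s)) in *. set (n := length s) in *.
  assert (Hg := log2_large n Hn).
  assert (HF := Flist_mul_le s). assert (HV := length_Vlist s). fold n in HF, HV.
  assert (HL := nlev_le s). fold n in HL. assert (HT := table_size n ltac:(lia)).
  assert (HC := cube_le_pow (Nat.log2 n)). assert (HB := Nat.log2_spec n ltac:(lia)).
  assert (Hgn := Nat.log2_lt_lin n ltac:(lia)).
  assert (HK := fan_large v ltac:(lia)). assert (HK1 := fan_pos v ltac:(lia)).
  assert (HKv := fan_le v).
  assert (Hmu : S (Nat.log2 (S (Nat.log2 n))) <= 16 * fan v).
  { eapply Nat.le_trans; [|exact HK]. apply le_n_S, Nat.log2_le_mono. lia. }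
  assert (Hmug : S (Nat.log2 (S (Nat.log2 n))) <= S (Nat.log2 n)) by (apply Nat.log2_lt_lin; lia).
  set (g := S (Nat.log2 n)) in *. set (mu := S (Nat.log2 g)) in *.
  set (F := length (Flist s)) in *. rewrite HV. unfold lsize.
  set (K := fan v) in *. set (L := nlev s) in *.
  assert (D := Nat.Div0.mul_div_le (n + F) (v * K)).
  set (q := (n + F) / (v * K)) in *.
  exists (F + 2 * (v * q)). split.
  - assert (HF2 : F <= n) by nia.
    assert (X1 : mu * F <= n) by nia.
    assert (X2 : mu * (v * q) <= 16 * (K * (v * q))) by nia.
    assert (X3 : K * (v * q) <= 2 * n) by lia. lia.
  - assert (T1 : v * 12 <= 12 * c * n) by nia.
    assert (T2 : v * 2 ^ hbits n <= 16 * c * n) by nia.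
    assert (T3 : v * F <= c * n) by nia.
    assert (T4 : L * (v * (K + 2)) <= 48 * c * c * n).
    { assert (U1 : v * (K + 2) <= (c * g) * (3 * (c * g))) by (apply Nat.mul_le_mono; lia).
      assert (U2 : L * (v * (K + 2)) <= (2 * g) * ((c * g) * (3 * (c * g))))
        by (apply Nat.mul_le_mono; lia).
      assert (U3 : (c * c) * (g * g * g) <= (c * c) * (8 * n)) by (apply Nat.mul_le_mono_l; lia).
      lia. }
    assert (T5 : L * (q * (v * K)) <= L * (n + F)) by (apply Nat.mul_le_mono_l; lia).
    lia.
Qed.

(** * Real logarithms and the leading constant *)

Open Scope R_scope.

Lemma ln2_pos : 0 < ln 2.
Proof. rewrite <- ln_1. apply ln_increasing; lra. Qed.

Lemma log2R_le a b : 0 < a -> a <= b -> log2R a <= log2R b.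
Proof.
  intros Ha Hab. unfold log2R. apply Rmult_le_compat_r.
  - left. apply Rinv_0_lt_compat, ln2_pos.
  - destruct Hab as [Hab|Hab]; [left; now apply ln_increasing|subst; right; reflexivity].
Qed.

Lemma log2R_mult a b : 0 < a -> 0 < b -> log2R (a * b) = log2R a + log2R b.
Proof. intros Ha Hb. unfold log2R. rewrite ln_mult by assumption. field. generalize ln2_pos; lra. Qed.

Lemma log2R_2 : log2R 2 = 1.
Proof. unfold log2R. field. generalize ln2_pos; lra. Qed.

Lemma log2R_pow k : log2R (INR (2 ^ k)) = INR k.
Proof.
  induction k as [|k IH].
  - simpl. unfold log2R. rewrite ln_1. field. generalize ln2_pos; lra.
  - rewrite Nat.pow_succ_r', mult_INR, log2R_mult, IH.
    + change (INR 2) with 2. rewrite log2R_2, S_INR. ring.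
    + simpl; lra.
    + apply lt_0_INR, pow2_pos.
Qed.

Lemma log2_le_log2R n : (0 < n)%nat -> INR (Nat.log2 n) <= log2R (INR n).
Proof.
  intros H. rewrite <- (log2R_pow (Nat.log2 n)). apply log2R_le.
  - apply lt_0_INR, pow2_pos.
  - apply le_INR, Nat.log2_spec, H.
Qed.

Lemma log2R_le_log2 n : (0 < n)%nat -> log2R (INR n) <= INR (S (Nat.log2 n)).
Proof.
  intros H. rewrite <- (log2R_pow (S (Nat.log2 n))). apply log2R_le.
  - now apply lt_0_INR.
  - apply le_INR, Nat.lt_le_incl, Nat.log2_spec, H.
Qed.

Definition loglog (n : nat) : R := log2R (log2R (INR n)).

Lemma loglog_ge n m : (2 ^ (2 ^ m) <= n)%nat -> INR m <= loglog n.
Proof.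
  intros H. rewrite <- (log2R_pow m). apply log2R_le; [apply lt_0_INR, pow2_pos|].
  rewrite <- log2R_pow. apply log2R_le; [apply lt_0_INR, pow2_pos|]. now apply le_INR.
Qed.

Lemma inv_loglog_cv C : Un_cv (fun n => C / loglog n) 0.
Proof.
  intros eps Heps. destruct (INR_unbounded (Rabs C / eps + 1)) as [m Hm].
  exists (2 ^ (2 ^ m))%nat. intros n Hn. unfold R_dist. rewrite Rminus_0_r.
  assert (Hl := loglog_ge n m Hn).
  assert (HC : 0 <= Rabs C / eps).
  { apply Rmult_le_pos; [apply Rabs_pos|left; now apply Rinv_0_lt_compat]. }
  assert (Hpos : 0 < loglog n) by lra.
  unfold Rdiv. rewrite Rabs_mult, (Rabs_right (/ loglog n)).
  2: { left. now apply Rinv_0_lt_compat. }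
  apply (Rmult_lt_reg_r (loglog n)); [exact Hpos|].
  rewrite Rmult_assoc, Rinv_l, Rmult_1_r by lra.
  apply (Rmult_lt_reg_r (/ eps)); [now apply Rinv_0_lt_compat|].
  replace (eps * loglog n * / eps) with (loglog n) by (field; lra).
  unfold Rdiv in *. lra.
Qed.

(** Let [y = loglog n] and [x = log sigma + y], so [1 <= y <= x]. There are at most [x + 2 <= 3 * x]
    levels with overhead at most [65 * n / y] each, and every [n] left over is at most
    [(n / y) * x]; hence [197 = 3 * 65 + 2]. *)
Lemma space_bound w c s : (256 <= length s)%nat ->
  (2 * S (Nat.log2 (length s)) <= w (length s))%nat ->
  (w (length s) <= c * S (Nat.log2 (length s)))%nat ->
  INR (length (encode w s)) <=
    (1 + INR (197 + (29 * c + 48 * c * c)) / loglog (length s)) *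
    (INR (length s) * log2R (INR (alph_size s)) + INR (length s) * loglog (length s)).
Proof.
  intros Hn Hw Hc. destruct (length_encode_le w c s Hn Hw Hc) as [E [HE Hlen]].
  set (D := (29 * c + 48 * c * c)%nat) in *. rewrite plus_INR.
  assert (Hy1 : 1 <= loglog (length s)) by (apply (loglog_ge _ 1); simpl; lia).
  assert (Hsig : (0 < alph_size s)%nat) by (apply alph_size_pos; lia).
  assert (Hls : 0 <= log2R (INR (alph_size s))).
  { eapply Rle_trans; [|now apply log2_le_log2R]. apply pos_INR. }
  assert (HlogN : log2R (INR (length s)) <= INR (S (Nat.log2 (length s)))) by (apply log2R_le_log2; lia).
  assert (HlogN2 : INR (Nat.log2 (length s)) <= log2R (INR (length s))) by (apply log2_le_log2R; lia).
  assert (Hl1 : 1 <= INR (Nat.log2 (length s))).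
  { apply (le_INR 1). assert (H := log2_large _ Hn). lia. }
  set (g := S (Nat.log2 (length s))) in *.
  assert (Hg : INR g <= 2 * log2R (INR (length s))).
  { unfold g. rewrite S_INR. lra. }
  assert (Hmu : loglog (length s) <= INR (S (Nat.log2 g))).
  { eapply Rle_trans; [|apply log2R_le_log2; unfold g; lia]. apply log2R_le; lra. }
  (* One of the two extra levels is the [S] in [nlev], the other comes from bounding [g] by twice
     the real logarithm. *)
  assert (HL : INR (nlev s) <= log2R (INR (alph_size s)) + loglog (length s) + 2).
  { unfold nlev, blk. fold g. rewrite S_INR.
    assert (H := log2_le_log2R (alph_size s * g) ltac:(unfold g; lia)).
    rewrite mult_INR, log2R_mult in H; try (apply lt_0_INR; unfold g; lia).
    assert (H2 : log2R (INR g) <= log2R (2 * log2R (INR (length s)))).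
    { apply log2R_le; [apply lt_0_INR; unfold g; lia|exact Hg]. }
    rewrite log2R_mult, log2R_2 in H2 by lra. unfold loglog. lra. }
  apply le_INR in HE, Hlen. rewrite plus_INR, !mult_INR, plus_INR in Hlen.
  rewrite !mult_INR in HE.
  assert (HnR := pos_INR (length s)). assert (HER := pos_INR E). assert (HDR := pos_INR D).
  set (n := INR (length s)) in *. set (y := loglog (length s)) in *.
  set (e := INR E) in *. set (d := INR D) in *.
  replace (n * log2R (INR (alph_size s)) + n * y) with (n * (log2R (INR (alph_size s)) + y)) by ring.
  set (x := log2R (INR (alph_size s)) + y) in *.
  assert (Hxy : y <= x) by (unfold x; lra).
  replace (INR 65) with 65 in HE by (simpl; lra).
  replace (INR 197) with 197 by (simpl; lra).
  assert (HyE : y * e <= 65 * n).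
  { eapply Rle_trans; [|exact HE]. now apply Rmult_le_compat_r. }
  assert (Hee : e <= 65 * (n / y)).
  { apply (Rmult_le_reg_l y); [lra|]. replace (y * (65 * (n / y))) with (65 * n) by (field; lra). exact HyE. }
  assert (Hny : 0 <= n / y) by (apply Rmult_le_pos; [exact HnR|left; apply Rinv_0_lt_compat; lra]).
  assert (Hn2 : n <= n / y * x).
  { replace n with (n / y * y) at 1 by (field; lra). now apply Rmult_le_compat_l. }
  assert (H1 : INR (nlev s) * (n + e) <= (x + 2) * (n + e)) by (apply Rmult_le_compat_r; lra).
  assert (H2 : (x + 2) * e <= (3 * x) * (65 * (n / y))) by (apply Rmult_le_compat; lra).
  assert (H3 : (d + 2) * n <= (d + 2) * (n / y * x)) by (apply Rmult_le_compat_l; lra).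
  replace ((1 + (197 + d) / y) * (n * x))
    with (x * n + (3 * x) * (65 * (n / y)) + (d + 2) * (n / y * x)) by (field; lra).
  lra.
Qed.

Theorem theorem1 :
  forall w : nat -> nat,
    (forall n : nat, 2 * S (Nat.log2 n) <= w n)%nat ->
    (exists c : nat, forall n : nat, (w n <= c * S (Nat.log2 n))%nat) ->
    exists (enc : list nat -> list bool) (P : list instr) (f : nat -> R),
      Un_cv f 0 /\
      (exists N : nat, forall s : list nat, (N <= length s)%nat ->
         INR (length (enc s)) <=
           (1 + f (length s)) *
           (INR (length s) * log2R (INR (alph_size s))
            + INR (length s) * log2R (log2R (INR (length s))))) /\
      (exists C : nat, forall (s : list nat) (i j : nat),
         (1 <= i)%nat -> (i <= j)%nat -> (j <= length s)%nat ->
         exists t : nat,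
           (t <= C * S (Nat.log2 (length s)))%nat /\
           let st := run (w (length s)) P t
                       (init_state (w (length s)) (enc s) (length s) i j) in
           halted P st = true /\ regs st 0 = num_distinct (substr s i j)).
Proof.
  intros w Hw [c Hc].
  exists (encode w), prog, (fun n => INR (197 + (29 * c + 48 * c * c)) / loglog n).
  split; [apply inv_loglog_cv|]. split.
  - exists 256%nat. intros s Hs. now apply space_bound.
  - exists (64 * c + 250)%nat. intros s i j Hi Hij Hj. now apply query.
Qed.
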